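(* Let $\Gamma\in C_b^1(\mathbb{R})$ be $2\pi$-periodic, let $H\in C_b^2(\mathbb{R}^2)$ be $2\pi$-periodic in each argument, and let $\omega,\theta_0\in L^\infty([0,1])$. Then the equation $$\partial_t\theta=\omega+K[\theta]+\varepsilon P[\theta;\omega]+\varepsilon T[\theta],\qquad \theta|_{t=0}=\theta_0$$ has a unique global strong solution for every $\varepsilon>0$. Moreover, for each final time $\tau>0$ and each $R>0$, the map $(\theta_0,\omega)\mapsto\theta$ is Lipschitz on the $R$-ball in $L^\infty([0,1])\times L^\infty([0,1])$, as a map into $C([0,\tau];L^\infty([0,1]))$.
   Context: $L^\infty([0,1])$ is real-valued with the essential supremum norm; $C_b^k$ denotes $C^k$ functions bounded together with all partial derivatives up to order $k$. The operators are $$K[\theta](x)=\int_0^1H(\theta(x),\theta(y))\Gamma(\theta(y)-\theta(x))\,dy,$$ $$P[\theta;\omega](x)=-\int_0^1\Gamma(\theta(y)-\theta(x))\bigl(\partial_1H(\theta(x),\theta(y))\omega(x)+\partial_2H(\theta(x),\theta(y))\omega(y)\bigr)dy,$$ $$T[\theta](x)=-\int_0^1\!\!\int_0^1\Gamma(\theta(y)-\theta(x))\partial_1H(\theta(x),\theta(y))H(\theta(x),\theta(z))\Gamma(\theta(z)-\theta(x))\,dz\,dy$$ $$\qquad-\int_0^1\!\!\int_0^1\Gamma(\theta(y)-\theta(x))\partial_2H(\theta(x),\theta(y))H(\theta(y),\theta(z))\Gamma(\theta(z)-\theta(y))\,dz\,dy.$$ A strong solution on $[0,\tau]$ is $\theta\in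 W^{1,\infty}([0,\tau];L^\infty([0,1]))$ satisfying the initial condition and the equation for a.e. $t\in[0,\tau]$; it is global if this holds on $[0,\tau]$ for every $\tau>0$. *)

(* Defs.v *)
From HB Require Import structures.
From mathcomp Require Import all_boot all_order all_algebra generic_quotient ring_quotient.
From mathcomp Require Import all_classical all_reals all_analysis ess_sup_inf.

Set Implicit Arguments.
Unset Strict Implicit.
Unset Printing Implicit Defensive.
Import Order.TTheory GRing.Theory Num.Theory.
Import numFieldNormedType.Exports.

Local Open Scope classical_set_scope.
Local Open Scope ring_scope.

(* L^oo(mu) as a real normed space: the library's lmodule of measurable
   functions with finite essential supremum norm, quotiented by a.e. equality. *)
Section Linfty.
Context d (T : measurableType d) (R : realType).
Variable mu : {measure set T -> \bar R}.

Definition one_le_infty : (1 <= +oo :> \bar R)%E := leey 1%E.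

Notation Lfun_oo := (LfunType mu one_le_infty).

Definition ae_zero : {pred Lfun_oo} :=
  [pred f : Lfun_oo | `[< f = cst 0 %[ae mu] >]].

Lemma ae_zeroP (f : Lfun_oo) : reflect (f = cst 0 %[ae mu]) (f \in ae_zero).
Proof. exact: asboolP. Qed.

Lemma ae_zero_closed : zmod_closed ae_zero.
Proof.
split; first exact/ae_zeroP/aeW.
move=> f g /ae_zeroP f0 /ae_zeroP g0; apply/ae_zeroP.
apply: filterS2 f0 g0 => x /(_ I) /= f0 /(_ I) /= g0 _ /=.
by rewrite -[LHS]/(f x - g x) f0 g0 subr0.
Qed.

HB.instance Definition _ := GRing.isZmodClosed.Build Lfun_oo ae_zero ae_zero_closed.

Definition Linfty := Quotient.quot ae_zero.

HB.instance Definition _ := GRing.Zmodule.on Linfty.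
HB.instance Definition _ := EqQuotient.on Linfty.

(* A class is applied to a point through its canonical representative. *)
Definition Linfty_fun (u : Linfty) : T -> R := repr u.
Coercion Linfty_fun : Linfty >-> Funclass.

Local Open Scope quotient_scope.

Lemma pi_LinftyP (f g : Lfun_oo) :
  \pi_Linfty f = \pi_Linfty g <-> f = g %[ae mu].
Proof.
have -> : (\pi_Linfty f = \pi_Linfty g) <-> (f - g \in ae_zero).
  by split=> [/eqP|] h; [|apply/eqP]; move: h; rewrite -Quotient.idealrBE.
split=> [/ae_zeroP|] h; [|apply/ae_zeroP]; apply: filterS h => x /(_ I) h _.
  by apply/eqP; rewrite -subr_eq0; apply/eqP.
by rewrite -[LHS]/(f x - g x) h subrr.
Qed.

Lemma repr_pi_Linfty (f : Lfun_oo) : repr (\pi_Linfty f) = f %[ae mu].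
Proof. by apply/pi_LinftyP; rewrite reprK. Qed.

Lemma Lfun_scaleE (a : R) (f : Lfun_oo) x : (a *: f) x = a * f x.
Proof. by []. Qed.

Definition scale_Linfty (a : R) (u : Linfty) : Linfty := \pi_Linfty (a *: repr u).

Lemma pi_scale (a : R) (f : Lfun_oo) :
  scale_Linfty a (\pi_Linfty f) = \pi_Linfty (a *: f).
Proof.
apply/pi_LinftyP; apply: filterS (repr_pi_Linfty f) => x /(_ I) h _.
by rewrite !Lfun_scaleE h.
Qed.

Lemma scale_LinftyA a b u :
  scale_Linfty a (scale_Linfty b u) = scale_Linfty (a * b) u.
Proof. by rewrite -[u]reprK [scale_Linfty b _]pi_scale !pi_scale scalerA. Qed.

Lemma scale_Linfty1 : left_id 1 scale_Linfty.
Proof. by move=> u; rewrite -[u]reprK !pi_scale scale1r. Qed.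

Lemma scale_LinftyDr : right_distributive scale_Linfty +%R.
Proof.
move=> a u v; rewrite -[u]reprK -[v]reprK.
by rewrite -[_ + _ in LHS]pi_addr !pi_scale scalerDr pi_addr.
Qed.

Lemma scale_LinftyDl u : {morph scale_Linfty^~ u : a b / a + b}.
Proof. by move=> a b; rewrite -[u]reprK !pi_scale scalerDl pi_addr. Qed.

HB.instance Definition _ := GRing.Zmodule_isLmodule.Build R Linfty
  scale_LinftyA scale_Linfty1 scale_LinftyDr scale_LinftyDl.

Definition norm_Linfty (u : Linfty) : R := fine ('N[mu]_+oo[EFin \o u])%E.

Lemma norm_pi_Linfty (f : Lfun_oo) :
  norm_Linfty (\pi_Linfty f) = fine ('N[mu]_+oo[EFin \o f])%E.
Proof.
congr fine; rewrite unlock; case: ifPn => // _; apply: eq_ess_sup.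
by apply: filterS (repr_pi_Linfty f) => x /(_ I) h; rewrite /= -h.
Qed.

Lemma ler_norm_LinftyD u v :
  norm_Linfty (u + v) <= norm_Linfty u + norm_Linfty v.
Proof.
rewrite -[u]reprK -[v]reprK -[_ + _ in leLHS]pi_addr !norm_pi_Linfty.
exact: ler_LnormD.
Qed.

Lemma norm_LinftyZ a u : norm_Linfty (a *: u) = `|a| * norm_Linfty u.
Proof.
rewrite -[u]reprK -[a *: _]/(scale_Linfty a _) pi_scale !norm_pi_Linfty.
by rewrite LnormZ fineM// -finite_norm_fine.
Qed.

Lemma norm_Linfty_eq0 u : norm_Linfty u = 0 -> u = 0.
Proof.
rewrite -[u]reprK norm_pi_Linfty => /fine_Lnormr_eq0 u0.
by rewrite -[0 in RHS]pi_zeror; apply/pi_LinftyP.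
Qed.

HB.instance Definition _ := Lmodule_isNormed.Build R Linfty
  ler_norm_LinftyD norm_LinftyZ norm_Linfty_eq0.

End Linfty.

Section Bochner.
Context d (T : measurableType d) (R : realType) (V : normedModType R).
Variable mu : {measure set T -> \bar R}.
Implicit Types (D : set T) (s f : T -> V).

Definition vector_simple s :=
  finite_set (range s) /\ forall v, measurable (s @^-1` [set v]).

Definition strongly_measurable D f :=
  exists s : nat -> T -> V,
    (forall n, vector_simple (s n)) /\
    \forall x \ae mu, D x -> s n x @[n --> \oo] --> f x.

Definition integrable_simple D s :=
  vector_simple s /\
  forall v, v != 0 -> (mu (D `&` s @^-1` [set v]) < +oo)%E.

(* Only the value 0 may be taken on a set of infinite measure; it contributes
   nothing to the sum. *)
Definition simple_integral D s : V :=
  \sum_(v \in range s) fine (mu (D `&` s @^-1` [set v])) *: v.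

(* [f] is Bochner integrable on [D] with integral [v]. *)
Definition is_bochner_integral D f (v : V) :=
  strongly_measurable D f /\
  exists s : nat -> T -> V,
    [/\ forall n, integrable_simple D (s n),
        (\int[mu]_(x in D) (`|f x - s n x|)%:E)%E @[n --> \oo] --> 0%E &
        simple_integral D (s n) @[n --> \oo] --> v].

(* f in L^oo(D; V), a Bochner space *)
Definition bochner_Linfty D f :=
  strongly_measurable D f /\
  exists M : R, \forall x \ae mu, D x -> `|f x| <= M.

End Bochner.

Section W1infty.
Context (R : realType) (V : normedModType R).
Implicit Types (tau : R) (u : R -> V).
Local Notation lambda := (@lebesgue_measure R).

(* phi in C_c^oo(]0, tau[) *)
Definition test_function tau (phi : R -> R) :=
  [/\ forall n t, derivable (phi^`(n))%classic t 1,
      compact (closure [set t | phi t != 0]) &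
      closure [set t | phi t != 0] `<=` `]0, tau[].

(* int_0^tau phi' u = - int_0^tau phi u' for every test function phi, as
   Bochner integrals. *)
Definition weak_derivative tau u (u' : R -> V) :=
  forall phi, test_function tau phi ->
  exists v : V,
    is_bochner_integral lambda `[0, tau] (fun t => phi^`()%classic t *: u t) v /\
    is_bochner_integral lambda `[0, tau] (fun t => phi t *: u' t) (- v).

(* u in W^{1,oo}([0, tau]; V), with weak derivative u' *)
Definition W1infty tau u (u' : R -> V) :=
  [/\ bochner_Linfty lambda `[0, tau] u,
      bochner_Linfty lambda `[0, tau] u' &
      weak_derivative tau u u'].

End W1infty.

(* [Cb dirs k f]: f is continuous and bounded together with all its iterated
   partial derivatives of order at most k along the directions in dirs. *)
Fixpoint Cb (R : realType) (V : normedModType R) (dirs : seq V) (k : nat)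
    (f : V -> R) : Prop :=
  [/\ continuous f,
      exists M : R, forall x, `|f x| <= M &
      if k is k'.+1 then
        forall e, e \in dirs ->
          (forall x, derivable f x e) /\ Cb dirs k' ('D_e f)
      else True].

Definition Cb_R (R : realType) (k : nat) (f : R -> R) :=
  Cb [:: 1 : R] k f.
Definition Cb_R2 (R : realType) (k : nat) (f : R * R -> R) :=
  Cb [:: ((1, 0) : R * R); ((0, 1) : R * R)] k f.

Section Equation.
Context (R : realType).
Variables (Gamma : R -> R) (H : R * R -> R).
Local Notation lambda := (@lebesgue_measure R).

Definition Linfty01 := Linfty (mrestr lambda (measurable_itv `[0, 1])).
HB.instance Definition _ := NormedModule.on Linfty01.
Definition Linfty01_fun (u : Linfty01) : R -> R := Linfty_fun u.
Coercion Linfty01_fun : Linfty01 >-> Funclass.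

Definition D1H (p : R * R) : R := 'D_(1, 0) H p.
Definition D2H (p : R * R) : R := 'D_(0, 1) H p.

Definition opK (theta : R -> R) (x : R) : R :=
  \int[lambda]_(y in `[0, 1])
    (H (theta x, theta y) * Gamma (theta y - theta x)).

Definition opP (theta omega : R -> R) (x : R) : R :=
  - \int[lambda]_(y in `[0, 1])
      (Gamma (theta y - theta x) *
       (D1H (theta x, theta y) * omega x + D2H (theta x, theta y) * omega y)).

Definition opT (theta : R -> R) (x : R) : R :=
  - (\int[lambda]_(y in `[0, 1]) \int[lambda]_(z in `[0, 1])
       (Gamma (theta y - theta x) * D1H (theta x, theta y) *
        H (theta x, theta z) * Gamma (theta z - theta x)))
  - (\int[lambda]_(y in `[0, 1]) \int[lambda]_(z in `[0, 1])
       (Gamma (theta y - theta x) * D2H (theta x, theta y) *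
        H (theta y, theta z) * Gamma (theta z - theta y))).

(* An element of W^{1,oo}([0, tau]; L^oo) is represented by its continuous
   representative, so that the initial condition makes sense; [dtheta] is
   its weak derivative.  The equation is an equality in L^oo([0, 1]). *)
Definition strong_solution (eps : R) (omega theta0 : Linfty01) (tau : R)
    (theta : R -> Linfty01) :=
  [/\ {within `[0, tau], continuous theta},
      theta 0 = theta0 &
      exists dtheta : R -> Linfty01,
        W1infty tau theta dtheta /\
        \forall t \ae lambda, t \in `[0, tau] ->
          (dtheta t : R -> R) =
          (fun x => omega x + opK (theta t) x
                    + eps * opP (theta t) omega x + eps * opT (theta t) x)
          %[ae lambda in `[0, 1]%classic]].

Definition global_strong_solution (eps : R) (omega theta0 : Linfty01)
    (theta : R -> Linfty01) :=
  forall tau : R, 0 < tau -> strong_solution eps omega theta0 tau theta.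

End Equation.

(* Main.v *)
Require Import Defs.
From mathcomp Require Import all_boot all_order all_algebra ring lra.
From mathcomp Require Import generic_quotient finmap.
From mathcomp Require Import all_classical all_reals all_analysis.
From mathcomp Require Import measurable_realfun ess_sup_inf.

Set Implicit Arguments.
Unset Strict Implicit.
Unset Printing Implicit Defensive.
Import Order.TTheory GRing.Theory Num.Theory.
Import numFieldNormedType.Exports.

Local Open Scope classical_set_scope.
Local Open Scope ring_scope.

(** The equation is an ordinary differential equation theta' = N(theta) in the Banach
    space L^oo([0, 1]), with a vector field N that is bounded and globally
    Lipschitz, so existence and stability come from the Cauchy-Lipschitz theory.

    The vector field. The double integrals satisfy T[theta] = P[theta; K[theta]]
    ([opTE]); hence N(theta) = nu + eps P[theta; nu] with nu = omega + K[theta]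
    ([velocityE]). K and P are integral operators whose kernels are bounded and
    Lipschitz, because Gamma is C^1 and H is C^2 with bounded derivatives. This
    gives a bound for N, a Lipschitz constant in theta that depends only on the norm
    of omega, and one in omega ([velocity_bounded], [velocity_lipschitz]).

    Existence. Euler polygons of step 2^(-n) converge, since the space is complete
    ([Linfty_complete]) and halving the step changes a polygon by O(2^(-n)). The
    limit satisfies |theta t - theta s - (t - s) N (theta s)| <= C (t - s)^2 for all
    s <= t ([solution_antiderivative]), which makes it a C^1 curve on the half line.
    A C^1 curve with Lipschitz derivative lies in W^{1,oo}: its pairings with test
    functions are Bochner integrals of Lipschitz curves, and these are the increments
    of antiderivatives ([lipschitz_bochner_integral], [antiderivative_W1infty]); the
    antiderivatives come from the same Euler scheme.

    Stability. Let theta be any strong solution and l a functional of norm at most 1.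
    Applying l to the Bochner integrals shows that l o theta is continuous with the
    continuous weak derivative l o N(theta) ([strong_solution_weak]). Real functions
    of this kind satisfy the mean value inequality ([weak_derivative_le]), by testing
    against smooth plateau functions. The norm is the supremum of the functionals
    ([Linfty_norming]: averages over sets suffice), so the difference w of two
    solutions obeys |w b - w a| <= (b - a) sup (p + Lam |w|) on every interval
    [a, b], with p a multiple of the distance of the two omega
    ([strong_solution_growth]). A Gronwall argument ([discrete_gronwall]) bounds w by
    the distance of the data. This is the Lipschitz dependence, and uniqueness is the
    case of equal data. *)

(** * Smooth cutoffs and weak derivatives of continuous functions *)

Section Smooth.
Context {R : realType}.
Implicit Types (f g : R -> R) (n : nat).

(** Recursion on the derivative, rather than iteration of it, turns each closure
    property of smooth functions into a plain induction on [n]. *)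
Fixpoint diffn n f : Prop :=
  if n is m.+1 then (forall x, derivable f x 1) /\ diffn m f^`()%classic
  else True.

Definition smooth f := forall n, diffn n f.

Lemma diffnW n f : diffn n.+1 f -> diffn n f.
Proof. by elim: n f => // n IH f [df /IH Df]; split. Qed.

Lemma diffn_cst n (c : R) : diffn n (cst c).
Proof.
elim: n c => //= n IH c; split; first by move=> x; exact: derivable_cst.
rewrite (_ : _^`()%classic = cst 0)//.
by apply/funext => x; rewrite derive1_cst.
Qed.

Lemma diffnD n f g : diffn n f -> diffn n g -> diffn n (f \+ g).
Proof.
elim: n f g => //= n IH f g [df Df] [dg Dg]; split=> [x|].
  exact: derivableD.
rewrite (_ : _^`()%classic = f^`()%classic \+ g^`()%classic); first exact: IH.
by apply/funext => x; rewrite [LHS]derive1E deriveD// -!derive1E.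
Qed.

Lemma diffnM n f g : diffn n f -> diffn n g -> diffn n (f \* g).
Proof.
elim: n f g => //= n IH f g [df Df] [dg Dg]; split=> [x|].
  exact: derivableM.
rewrite (_ : _^`()%classic = (f \* g^`()%classic) \+ (g \* f^`()%classic)).
  by apply: diffnD; apply: IH => //; apply: diffnW.
by apply/funext => x; rewrite [LHS]derive1E deriveM// -!derive1E.
Qed.

Lemma diffn_comp n f g : diffn n f -> diffn n g -> diffn n (f \o g).
Proof.
elim: n f g => //= n IH f g [df Df] [dg Dg]; split=> [x|].
  by apply/derivable1_diffP/differentiable_comp; apply/derivable1_diffP.
rewrite (_ : _^`()%classic = (f^`()%classic \o g) \* g^`()%classic).
  apply: diffnM => //; apply: IH => //; apply: diffnW; split => //.
by apply/funext => x; rewrite derive1_comp.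
Qed.

Lemma diffn_affine n (a b : R) : diffn n (fun x => a * x + b).
Proof.
have dab (x : R) : is_derive x 1 (fun x => a * x + b) a.
  rewrite (_ : (fun _ => _) = cst a * id + cst b)//.
  by apply: is_derive_eq; rewrite addr0 scaler0 addr0 [LHS]mulr1.
case: n => //= n; split => [x|]; first exact: ex_derive.
rewrite (_ : _^`()%classic = cst a); first exact: diffn_cst.
by apply/funext => x; rewrite derive1E derive_val.
Qed.

Lemma smoothD f g : smooth f -> smooth g -> smooth (f \+ g).
Proof. by move=> sf sg n; exact: diffnD. Qed.

Lemma smoothM f g : smooth f -> smooth g -> smooth (f \* g).
Proof. by move=> sf sg n; exact: diffnM. Qed.

Lemma smooth_comp f g : smooth f -> smooth g -> smooth (f \o g).
Proof. by move=> sf sg n; exact: diffn_comp. Qed.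

Lemma smooth_derivable f x : smooth f -> derivable f x 1.
Proof. by move=> /(_ 1%N)[]. Qed.

Lemma smooth_derive f : smooth f -> smooth f^`()%classic.
Proof. by move=> sf n; have [] := sf n.+1. Qed.

Lemma smooth_derive1n f n x : smooth f -> derivable (f^`(n))%classic x 1.
Proof.
elim: n f => [|n IH] f sf; first exact: smooth_derivable.
by rewrite derive1Sn; exact/IH/smooth_derive.
Qed.

Lemma smooth_continuous f : smooth f -> continuous f.
Proof.
by move=> sf x; apply/differentiable_continuous/derivable1_diffP/smooth_derivable.
Qed.

(** The functions x^(-k) e^(-1/x), extended by 0 to the nonpositive half line.
    Differentiation maps the family into its own linear span, so one step of
    differentiability for every [k] already gives smoothness. *)
Definition flat k : R -> R :=
  fun x => if 0 < x then x ^- k * expR (- x^-1) else 0.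

(** The factor e^(-1/x) beats every power of x: e^y >= y^(k+1) / (k+1)!. *)
Lemma flat_lin k x : `|flat k x| <= k.+1`!%:R * `|x|.
Proof.
rewrite /flat; case: ifPn => x0; last by rewrite normr0.
have xV : 0 < x^-1 by rewrite invr_gt0.
rewrite ger0_norm; last by rewrite mulr_ge0 ?expR_ge0// invr_ge0 exprn_ge0// ltW.
have -> : x ^- k * expR (- x^-1) = x^-1 ^+ k / expR x^-1.
  by rewrite exprVn expRN.
rewrite (gtr0_norm x0) ler_pdivrMr ?expR_gt0//.
have := expR_ge1Dxn k (ltW xV).
have F0 : 0 < (k.+1)`!%:R :> R by rewrite ltr0n fact_gt0.
move=> h; have {}h : x^-1 ^+ k.+1 <= k.+1`!%:R * expR x^-1.
  rewrite -ler_pdivrMl// mulrC; apply: le_trans h; lra.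
rewrite [leRHS]mulrAC -ler_pdivrMr// mulrC -exprS; exact: h.
Qed.

Lemma flat_cvg0 k : flat k h @[h --> 0^'] --> (0 : R).
Proof.
apply/cvgr0Pnorm_le => e e0; near=> h.
apply: le_trans (flat_lin _ _) _.
rewrite -ler_pdivlMl ?ltr0n ?fact_gt0//; near: h; apply: dnbhs0_le.
by rewrite mulr_gt0// invr_gt0 ltr0n fact_gt0.
Unshelve. all: by end_near.
Qed.

Lemma flat_is_derive k (x : R) :
  is_derive x 1 (flat k) (flat k.+2 x - k%:R * flat k.+1 x).
Proof.
have [x0|x0|->] := ltgtP x 0.
- rewrite /flat !ifF ?mulr0 ?subr0; try by apply/negbTE; rewrite -leNgt ltW.
  apply: (@near_eq_is_derive _ _ _ (cst 0)) => //.
  near=> y; rewrite ifF//; apply/negbTE; rewrite -leNgt ltW//.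
  by near: y; exact: lt_nbhsl.
- apply: (@near_eq_is_derive _ _ _
    ((fun y : R => y^-1) ^+ k * (expR \o (- (fun y : R => y^-1))))).
  + near=> y; rewrite /flat ifT ?exprVn//=; last by near: y; exact: lt_nbhsr.
    by rewrite -exprVn; congr (_ * _); elim: k => [|k IH]; rewrite ?expr0 ?exprS//= -IH.
  + have xn0 : x != 0 by rewrite gt_eqF.
    have dV : is_derive x 1 (fun y : R => y^-1) (- x ^- 2).
      by apply: is_derive_eq (is_deriveV _ (is_derive_id _ _)) _ => //=; rewrite [_ *: _]mulr1.
    have dE := is_derive1_comp (f := expR) (g := - (fun y : R => y^-1))
        (is_derive_expR _) (is_deriveN dV).
    apply: is_derive_eq (is_deriveM (is_deriveX k dV) dE) _ => /=.
    rewrite /flat x0 /= /GRing.scale /= -[(- _) x]/(- x^-1) -!exprVn opprK.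
    have -> : ((fun y : R => y^-1) ^+ k) x = x^-1 ^+ k.
      by elim: (k) => [|j IH]; rewrite ?expr0 ?exprS//= -IH.
    have -> : k%:R * x^-1 ^+ k.-1 * - x^-1 ^+ 2 = - (k%:R * x^-1 ^+ k.+1).
      by case: (k) => [|j]; rewrite ?mul0r ?oppr0//= !exprS; ring.
    by rewrite !exprS; ring.
  (* At 0 the difference quotient of flat k is flat (k + 1). *)
- have z0 j : flat j 0 = 0 by rewrite /flat ltxx.
  rewrite !z0 mulr0 subr0.
  have c0 : h^-1 *: ((flat k \o shift 0) (h *: 1) - flat k 0) @[h --> (0 : R)^'] --> (0 : R).
    apply: cvg_trans (flat_cvg0 k.+1); apply: near_eq_cvg; near=> h.
    rewrite z0 subr0 /= addr0 [h *: 1]mulr1 /flat; case: ifPn => _; last by rewrite scaler0.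
    by rewrite exprS invfM /GRing.scale/= mulrA.
  apply: DeriveDef; first by apply/cvg_ex; exists 0.
  exact: cvg_lim.
Unshelve. all: by end_near. Qed.

Lemma flat_smooth k : smooth (flat k).
Proof.
move=> n; elim: n k => //= n IH k; split=> [x|].
  by have [] := flat_is_derive k x.
rewrite (_ : _^`()%classic = flat k.+2 \+ (cst (- k%:R) \* flat k.+1)).
  by apply: diffnD => //; apply: diffnM => //; exact: diffn_cst.
apply/funext => x; rewrite derive1E; have [_ ->] := flat_is_derive k x.
by rewrite /= mulNr.
Qed.

Lemma flat_ge0 k x : 0 <= flat k x.
Proof.
rewrite /flat; case: ifPn => // x0.
by rewrite mulr_ge0 ?expR_ge0// invr_ge0 exprn_ge0// ltW.
Qed.

Lemma flat_gt0 k x : 0 < x -> 0 < flat k x.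
Proof.
by move=> x0; rewrite /flat x0 mulr_gt0 ?expR_gt0// invr_gt0 exprn_gt0.
Qed.

Lemma flat_le0 k x : x <= 0 -> flat k x = 0.
Proof. by rewrite /flat leNgt => /negbTE ->. Qed.

Lemma flat0_le : {homo flat 0 : x y / x <= y}.
Proof.
move=> x y xy; have [x0|x0] := leP x 0; first by rewrite flat_le0 ?flat_ge0.
have y0 := lt_le_trans x0 xy.
by rewrite /flat x0 y0 !expr0 !invr1 !mul1r ler_expR lerN2 lef_pV2.
Qed.

(** Composing [flat 0] with itself gives a smooth step without any division: the
    inner function runs from 0 to 1, and the outer one vanishes as soon as the
    inner one exceeds 1/2, that is for x >= 1/ln 2. *)
Definition step (x : R) := flat 0 (2^-1 - flat 0 x).
Definition step_width : R := (ln 2)^-1.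

Lemma step_width_gt0 : 0 < step_width.
Proof. by rewrite invr_gt0 ln_gt0// ltr1n. Qed.

Lemma step_smooth : smooth step.
Proof.
rewrite (_ : step = flat 0 \o ((cst 2^-1) \+ ((fun x => (-1) * x + 0) \o flat 0))).
  apply: smooth_comp; first exact: flat_smooth.
  apply: smoothD; first by move=> n; exact: diffn_cst.
  apply: smooth_comp; last exact: flat_smooth.
  by move=> n; exact: diffn_affine.
by apply/funext => x; rewrite /step /= addr0 mulN1r.
Qed.

Lemma step_ninc : {homo step : x y /~ x <= y}.
Proof. by move=> x y xy; apply: flat0_le; rewrite lerB// flat0_le. Qed.

Lemma step_left x : x <= 0 -> step x = step 0.
Proof. by move=> x0; rewrite /step (@flat_le0 _ x)// (@flat_le0 _ 0). Qed.

Lemma step0_gt0 : 0 < step 0.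
Proof. by rewrite /step (@flat_le0 _ 0)// subr0 flat_gt0// invr_gt0. Qed.

Lemma step_right x : step_width <= x -> step x = 0.
Proof.
move=> wx; apply: flat_le0; rewrite subr_le0.
apply: le_trans (flat0_le wx); rewrite /flat step_width_gt0.
by rewrite expr0 invr1 mul1r invrK expRN lnK// posrE.
Qed.

Lemma step_is_derive (x : R) :
  is_derive x 1 step (- (flat 2 (2^-1 - flat 0 x) * flat 2 x)).
Proof.
have d0 (y : R) : is_derive y 1 (flat 0) (flat 2 y).
  by apply: is_derive_eq (flat_is_derive _ _) _; rewrite mul0r subr0.
have dB : is_derive x 1 (cst 2^-1 - flat 0) (- flat 2 x).
  by apply: is_derive_eq (is_deriveB (is_derive_cst _ _ _) (d0 x)) _; rewrite sub0r.
by apply: is_derive_eq (is_derive1_comp (f := flat 0) (d0 _) dB) _; rewrite mulrN.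
Qed.

(** [step] rescaled so that it falls from its maximum to 0 across [a, a + d]. The
    difference of two such cutoffs is a test function. *)
Definition cut (a d x : R) := step (step_width / d * x + - (step_width / d * a)).

Section Cut.
Variables (a d : R).
Hypothesis d0 : 0 < d.

Let c := step_width / d.

Let c_gt0 : 0 < c. Proof. by rewrite divr_gt0// step_width_gt0. Qed.

Lemma cut_smooth : smooth (cut a d).
Proof.
apply: (@smooth_comp step (fun x => c * x + - (c * a))); first exact: step_smooth.
by move=> n; exact: diffn_affine.
Qed.

Lemma cut_left x : x <= a -> cut a d x = step 0.
Proof. by move=> xa; apply: step_left; rewrite subr_le0 ler_pM2l. Qed.

Lemma cut_right x : a + d <= x -> cut a d x = 0.
Proof.
move=> xa; apply: step_right; rewrite -mulrBr -/c.
have -> : step_width = c * d by rewrite /c mulfVK ?gt_eqF.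
by rewrite ler_pM2l// lerBrDl.
Qed.

Lemma cut_derive x : (cut a d)^`()%classic x =
  - (flat 2 (2^-1 - flat 0 (c * x - c * a)) * flat 2 (c * x - c * a)) * c.
Proof.
have dab : is_derive x 1 (cst c * id - cst (c * a)) c.
  by apply: is_derive_eq; rewrite subr0 scaler0 addr0 [LHS]mulr1.
rewrite derive1E.
by have [_ <-] := is_derive1_comp (g := cst c * id - cst (c * a)) (step_is_derive (c * x - c * a)) dab.
Qed.

Lemma cut_derive_le0 x : (cut a d)^`()%classic x <= 0.
Proof.
rewrite cut_derive mulNr oppr_le0.
by rewrite mulr_ge0 ?(ltW c_gt0)// mulr_ge0 ?flat_ge0.
Qed.

Lemma cut_derive_left x : x <= a -> (cut a d)^`()%classic x = 0.
Proof.
move=> xa; rewrite cut_derive (@flat_le0 2 (c * x - c * a)) ?mulr0 ?oppr0 ?mul0r//.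
by rewrite subr_le0 ler_pM2l.
Qed.

Lemma cut_derive_right x : a + d <= x -> (cut a d)^`()%classic x = 0.
Proof.
move=> xa; rewrite cut_derive (@flat_le0 2 (2^-1 - _)) ?mul0r ?oppr0 ?mul0r//.
rewrite subr_le0; apply: (@le_trans _ _ (flat 0 step_width)).
  by rewrite /flat step_width_gt0 expr0 invr1 mul1r invrK expRN lnK// posrE.
apply: flat0_le; have -> : step_width = c * d by rewrite /c mulfVK ?gt_eqF.
by rewrite -mulrBr ler_pM2l// lerBrDl.
Qed.

End Cut.

Lemma cut_le a b d x : 0 < d -> a <= b -> cut a d x <= cut b d x.
Proof.
move=> d0 ab; apply: step_ninc; rewrite lerD2l lerN2 ler_pM2l//.
by rewrite divr_gt0// step_width_gt0.
Qed.

(* Otherwise unification unfolds cut down to its exponentials. *)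
Opaque cut.

Local Notation lambda := (@lebesgue_measure R).

Lemma continuous_integrable f (a b : R) :
  {within `[a, b], continuous f} -> lambda.-integrable `[a, b] (EFin \o f).
Proof. exact/continuous_compact_integrable/segment_compact. Qed.

Lemma smooth_FTC f (a b : R) : a < b -> smooth f ->
  \int[lambda]_(x in `[a, b]) (f^`()%classic x) = f b - f a.
Proof.
move=> ab sf; have cf := smooth_continuous sf.
rewrite /Rintegral (@continuous_FTC2 _ _ f)//.
- by apply: continuous_subspaceT; exact/smooth_continuous/smooth_derive.
- split=> [x _||]; first exact: smooth_derivable.
    exact/cvg_at_right_filter/cf.
  exact/cvg_at_left_filter/cf.
Qed.

Lemma within_continuous_cvg (tau : R) (f : R -> R) x : 0 < x < tau ->
  {within `[0, tau], continuous f} -> {for x, continuous f}.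
Proof.
move=> /andP[x0 xt] /continuous_within_itvP => /(_ (lt_trans x0 xt))[+ _ _].
by apply; rewrite in_itv/= x0 xt.
Qed.

Lemma derive1_combination f g p (a b M x : R) :
  smooth f -> smooth g -> smooth p ->
  ((cst a \* f) \+ ((cst b \* g) \+ ((fun x => M * x + 0) \* p)))^`()%classic x =
  a * f^`()%classic x + b * g^`()%classic x + M * p x + M * x * p^`()%classic x.
Proof.
move=> sf sg sp.
have dS k : smooth k -> is_derive x 1 k (k^`()%classic x).
  by move=> sk; rewrite derive1E; apply/derivableP/smooth_derivable.
have dM : is_derive x 1 (fun x => M * x + 0) M.
  rewrite (_ : (fun _ => _) = cst M * id); last first.
    by apply/funext => y /=; rewrite addr0.
  by apply: is_derive_eq; rewrite scaler0 addr0 [LHS]mulr1.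
rewrite derive1E; have [_ ->] := is_deriveD (is_deriveM (is_derive_cst a _ _) (dS _ sf))
  (is_deriveD (is_deriveM (is_derive_cst b _ _) (dS _ sg)) (is_deriveM dM (dS _ sp))).
rewrite !scaler0 !addr0.
have E (A B C D : R) : a * C + (b * B + (M * x * A + D * M)) =
  a * C + b * B + M * D + M * x * A by ring.
by apply: etrans (E _ _ _ _) _.
Qed.

(** If g - M id increased from s to t, test against the plateau function [phi] that
    rises just after s and falls just after t. As [phi] is nonnegative and g' <= M
    in the weak sense, the integral of phi' (g - M id) is nonnegative; but phi'
    only charges neighbourhoods of s, with a positive sign, and of t, with a
    negative sign, where g - M id lies below [c1] and above [c2] > [c1]. Rather
    than split that integral, the integrand phi' g + phi h, whose integral is 0, is
    bounded by the derivative of one explicit smooth function [Psi]. *)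
Lemma weak_derivative_le_oo (tau : R) (g h : R -> R) (a b M : R) :
  0 <= a -> b <= tau ->
  {within `[0, tau], continuous g} -> {within `[0, tau], continuous h} ->
  (forall phi, test_function tau phi ->
     \int[lambda]_(x in `[0, tau]) (phi^`()%classic x * g x) =
     - \int[lambda]_(x in `[0, tau]) (phi x * h x)) ->
  (forall x, a < x < b -> h x <= M) ->
  forall s t, a < s -> s < t -> t < b -> g t - g s <= M * (t - s).
Proof.
move=> a0 btau cg ch weak hM s t as_ st tb.
rewrite leNgt; apply/negP => gst.
pose k x := g x - M * x.
have kst : k s < k t by rewrite /k; lra.
pose c1 := (2 * k s + k t) / 3; pose c2 := (k s + 2 * k t) / 3.
have c12 : c1 < c2 by rewrite /c1 /c2; lra.
have ck x : 0 < x < tau -> {for x, continuous k}.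
  move=> xt; apply: cvgB; first exact: (within_continuous_cvg xt).
  by apply: cvgM; [exact: cvg_cst|exact: cvg_id].
have tau_gt0 : 0 < tau by lra.
have s_in : 0 < s < tau by lra.
have t_in : 0 < t < tau by lra.
have /(ck s s_in)/nbhs_ballP[d1 /= d10 kd1] : \forall y \near k s, y < c1.
  by apply: lt_nbhsl; rewrite /c1; lra.
have /(ck t t_in)/nbhs_ballP[d2 /= d20 kd2] : \forall y \near k t, c2 < y.
  by apply: lt_nbhsr; rewrite /c2; lra.
pose d := Num.min (Num.min d1 d2) (b - t) / 2.
have d_gt0 : 0 < d by rewrite /d divr_gt0// !lt_min d10 d20/= subr_gt0.
have [dd1 dd2 dbt] : [/\ d < d1, d < d2 & t + d < b].
  have : 2 * d <= Num.min (Num.min d1 d2) (b - t) by rewrite /d; lra.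
  by rewrite !le_min => /andP[/andP[]]; split; lra.
have [s_ge0 t_ge0 sdtau tdtau] : [/\ 0 <= s, 0 <= t, s + d <= tau & t + d <= tau].
  by split; lra.
have sdtd : s + d <= t + d by rewrite lerD2r ltW.
have combine (A B p G K x : R) : A * (G - M * x - c2) <= 0 ->
    B * (c1 - (G - M * x)) <= 0 -> p * (K - M) <= 0 ->
    (A - B) * G + p * K <= c2 * A - c1 * B + M * p + M * x * (A - B).
  clear; lra.
pose phi x := cut t d x - cut s d x.
have phi_ge0 x : 0 <= phi x by rewrite subr_ge0; apply: cut_le => //; exact: ltW.
have phi_supp x : phi x != 0 -> s <= x <= t + d.
  apply: contra_neqT; rewrite negb_and -!ltNge => /orP[/ltW xs|/ltW xt].
    by rewrite /phi (cut_left d_gt0 xs) (cut_left d_gt0 (le_trans xs (ltW st))) subrr.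
  by rewrite /phi (cut_right d_gt0 xt) (cut_right d_gt0 (le_trans sdtd xt)) subrr.
have phi_smooth : smooth phi.
  rewrite (_ : phi = cut t d \+ (cst (-1) \* cut s d)).
    apply: smoothD; first exact: cut_smooth.
    by apply: smoothM; [move=> n; exact: diffn_cst|exact: cut_smooth].
  by apply/funext => x; rewrite /= mulN1r.
have dphi x : phi^`()%classic x = (cut t d)^`()%classic x - (cut s d)^`()%classic x.
  rewrite [LHS]derive1E deriveB -?derive1E//; exact/smooth_derivable/cut_smooth.
have phi_cl : closure [set x | phi x != 0] `<=` `[s, t + d].
  rewrite [X in _ `<=` X](closure_id _).1; last exact: itv_closed.
  by apply: closureS => x /= /phi_supp; rewrite in_itv.
have phi_test : test_function tau phi.
  split=> [n x||]; first exact: smooth_derive1n.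
    apply: (@subclosed_compact _ _ `[s, t + d]) => //; first exact: closed_closure.
    exact: segment_compact.
  by move=> x /phi_cl; rewrite /= !in_itv/=; lra.
(* Where phi' is nonzero, phi' (g - M id) <= c2 (cut t d)' - c1 (cut s d)'; the
   last summand of Psi accounts for the affine part M id. *)
pose Psi := (cst c2 \* cut t d) \+ ((cst (- c1) \* cut s d) \+ ((fun x => M * x + 0) \* phi)).
have Psi_smooth : smooth Psi.
  have scut e : smooth (cut e d) by exact: cut_smooth.
  have scst e : smooth (cst e) by move=> n; exact: diffn_cst.
  apply: smoothD; first exact: smoothM.
  apply: smoothD; apply: smoothM => // n; exact: diffn_affine.
have dPsi x : Psi^`()%classic x = c2 * (cut t d)^`()%classic x
    - c1 * (cut s d)^`()%classic x + M * phi x + M * x * phi^`()%classic x.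
  rewrite derive1_combination//; do ?exact: cut_smooth.
  by rewrite mulNr.
have cphi : continuous phi by exact: smooth_continuous.
have cdphi : continuous phi^`()%classic by exact/smooth_continuous/smooth_derive.
have := weak phi phi_test.
have ig : lambda.-integrable `[0, tau] (EFin \o (fun x => phi^`()%classic x * g x)).
  apply: continuous_integrable => x; apply: cvgM; last exact: cg.
  exact: (continuous_subspaceT cdphi).
have ih : lambda.-integrable `[0, tau] (EFin \o (fun x => phi x * h x)).
  apply: continuous_integrable => x; apply: cvgM; last exact: ch.
  exact: (continuous_subspaceT cphi).
move/eqP; rewrite -addr_eq0 -RintegralD//.
apply/negP; rewrite lt_eqF//.
apply: (@le_lt_trans _ _ (\int[lambda]_(x in `[0, tau]) Psi^`()%classic x)).
  apply: le_Rintegral => //.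
  - exact: (integrableD _ ig ih).
  - by apply/continuous_integrable/continuous_subspaceT/smooth_continuous/smooth_derive.
  move=> x _; rewrite dPsi dphi.
  have T1 : (cut t d)^`()%classic x * (k x - c2) <= 0.
    have [xt|tx] := leP x t; first by rewrite cut_derive_left ?mul0r.
    have [xt|xt] := leP (t + d) x; first by rewrite cut_derive_right ?mul0r.
    rewrite mulr_le0_ge0 ?cut_derive_le0// subr_ge0 ltW//.
    by apply: kd2; rewrite /ball/= ltr_norml; lra.
  have S1 : (cut s d)^`()%classic x * (c1 - k x) <= 0.
    have [xt|tx] := leP x s; first by rewrite cut_derive_left ?mul0r.
    have [xt|xt] := leP (s + d) x; first by rewrite cut_derive_right ?mul0r.
    rewrite mulr_le0_ge0 ?cut_derive_le0// subr_ge0 ltW//.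
    by apply: kd1; rewrite /ball/= ltr_norml; lra.
  have P1 : phi x * (h x - M) <= 0.
    have [->|/phi_supp xst] := eqVneq (phi x) 0; first by rewrite mul0r.
    have axb : a < x < b.
      by move: xst as_ dbt; clear; lra.
    have hx : h x - M <= 0 by rewrite subr_le0 hM.
    exact: (mulr_ge0_le0 (phi_ge0 x) hx).
  exact: combine T1 S1 P1.
rewrite (smooth_FTC tau_gt0 Psi_smooth).
have tR := cut_right d_gt0 tdtau; have sR := cut_right d_gt0 sdtau.
have tL := cut_left d_gt0 t_ge0; have sL := cut_left d_gt0 s_ge0.
rewrite /Psi /= /phi tR sR tL sL.
have := step0_gt0; move: c12 (step 0) => c12 S S0.
have -> : c2 * 0 + (- c1 * 0 + (M * tau + 0) * (0 - 0)) -
  (c2 * S + (- c1 * S + (M * 0 + 0) * (S - S))) = - ((c2 - c1) * S) by ring.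
by rewrite oppr_lt0; apply: mulr_gt0; rewrite ?subr_gt0.
Qed.

(** The fundamental theorem for weak derivatives, in the form of a one-sided
    estimate; the end points are reached by continuity. *)
Lemma weak_derivative_le (tau : R) (g h : R -> R) (a b M : R) :
  0 <= a -> a <= b -> b <= tau ->
  {within `[0, tau], continuous g} -> {within `[0, tau], continuous h} ->
  (forall phi, test_function tau phi ->
     \int[lambda]_(x in `[0, tau]) (phi^`()%classic x * g x) =
     - \int[lambda]_(x in `[0, tau]) (phi x * h x)) ->
  (forall x, a < x < b -> h x <= M) ->
  g b - g a <= M * (b - a).
Proof.
move=> a0; rewrite le_eqVlt => /predU1P[->|ab] btau cg ch weak hM.
  by rewrite !subrr mulr0.
have inner := weak_derivative_le_oo a0 btau cg ch weak hM.
have cg' : {within `[a, b], continuous g}.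
  by apply: continuous_subspaceW cg => x; rewrite /= !in_itv/=; lra.
have /(continuous_within_itvP _ ab)[_ ga gb] := cg'.
have bound_s t : a < t < b -> g t - g a <= M * (t - a).
  move=> /andP[at_ tb]; rewrite -subr_ge0.
  have lim : M * (t - s) - (g t - g s) @[s --> a^'+] --> M * (t - a) - (g t - g a).
    apply: cvgB; last by apply: cvgB => //; exact: cvg_cst.
    apply: cvgM; first exact: cvg_cst.
    by apply: cvgB; [exact: cvg_cst|exact/cvg_at_right_filter/cvg_id].
  rewrite -(cvg_lim _ lim)//; apply: limr_ge; first by apply/cvg_ex; eexists; exact: lim.
  near=> s; rewrite subr_ge0.
  have as_ : a < s by near: s; exact: nbhs_right_gt.
  have st : s < t by near: s; exact: nbhs_right_lt.
  exact: inner.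
rewrite -subr_ge0.
have lim : M * (t - a) - (g t - g a) @[t --> b^'-] --> M * (b - a) - (g b - g a).
  apply: cvgB; last by apply: cvgB => //; exact: cvg_cst.
  apply: cvgM; first exact: cvg_cst.
  by apply: cvgB; [exact/cvg_at_left_filter/cvg_id|exact: cvg_cst].
rewrite -(cvg_lim _ lim)//; apply: limr_ge; first by apply/cvg_ex; eexists; exact: lim.
near=> t; rewrite subr_ge0.
have at_ : a < t by near: t; exact: nbhs_left_gt.
have tb : t < b by near: t; exact: nbhs_left_lt.
by apply: bound_s; rewrite at_.
Unshelve. all: by end_near. Qed.

Lemma weak_derivativeB (tau : R) (g h g' h' : R -> R) :
  {within `[0, tau], continuous g} -> {within `[0, tau], continuous h} ->
  {within `[0, tau], continuous g'} -> {within `[0, tau], continuous h'} ->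
  (forall phi, test_function tau phi ->
     \int[lambda]_(x in `[0, tau]) (phi^`()%classic x * g x) =
     - \int[lambda]_(x in `[0, tau]) (phi x * h x)) ->
  (forall phi, test_function tau phi ->
     \int[lambda]_(x in `[0, tau]) (phi^`()%classic x * g' x) =
     - \int[lambda]_(x in `[0, tau]) (phi x * h' x)) ->
  forall phi, test_function tau phi ->
     \int[lambda]_(x in `[0, tau]) (phi^`()%classic x * (g \- g') x) =
     - \int[lambda]_(x in `[0, tau]) (phi x * (h \- h') x).
Proof.
move=> cg ch cg' ch' w w' phi tphi.
have [d _ _] := tphi.
have cphi : continuous phi.
  by move=> x; apply/differentiable_continuous/derivable1_diffP/(d 0%N).
have cdphi : continuous phi^`()%classic.
  by move=> x; apply/differentiable_continuous/derivable1_diffP/(d 1%N).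
have split_int (p k k' : R -> R) : continuous p ->
    {within `[0, tau], continuous k} -> {within `[0, tau], continuous k'} ->
    \int[lambda]_(x in `[0, tau]) (p x * (k \- k') x) =
    \int[lambda]_(x in `[0, tau]) (p x * k x) - \int[lambda]_(x in `[0, tau]) (p x * k' x).
  move=> cp ck ck'.
  have int q : {within `[0, tau], continuous q} ->
      lambda.-integrable `[0, tau] (EFin \o (fun x => p x * q x)).
    move=> cq; apply: continuous_integrable => x; apply: cvgM; last exact: cq.
    exact: (continuous_subspaceT cp).
  rewrite -RintegralB//; [|exact: int|exact: int].
  by apply: eq_Rintegral => x _; rewrite -mulrBr.
by rewrite !split_int// w// w'// opprD.
Qed.

End Smooth.

(** * Bochner integrals through bounded functionals *)

(** The integrands in the definition of the Bochner integral are not known to be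
    measurable. The integral of a nonnegative function is a supremum over the
    simple functions below it, so it is monotone without any measurability. *)
Lemma le_integral_ge0 d (T : measurableType d) (R : realType)
    (mu : {measure set T -> \bar R}) (D : set T) (f k : T -> \bar R) :
  (forall x, 0 <= f x)%E -> (forall x, 0 <= k x)%E ->
  (forall x, D x -> (f x <= k x)%E) ->
  (\int[mu]_(x in D) f x <= \int[mu]_(x in D) k x)%E.
Proof.
move=> f0 k0 fk; rewrite !ge0_integralE//.
apply: le_ereal_sup => _ [h /= hf <-]; exists h => //= x.
apply: le_trans (hf x) _; rewrite /patch; case: ifPn => // /set_mem Dx.
exact: fk.
Qed.

Lemma ae_le_integral_ge0 d (T : measurableType d) (R : realType)
    (mu : {measure set T -> \bar R}) (D : set T) (f k : T -> \bar R) :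
  measurable D -> measurable_fun D f ->
  (forall x, (0 <= f x)%E) -> (forall x, (0 <= k x)%E) ->
  (\forall x \ae mu, D x -> (f x <= k x)%E) ->
  (\int[mu]_(x in D) f x <= \int[mu]_(x in D) k x)%E.
Proof.
move=> mD mf f0 k0 [N [mN N0 fkN]].
rewrite (ge0_negligible_integral mN mD mf _ N0)//.
rewrite [leLHS]integral_mkcond [leRHS]integral_mkcond.
apply: le_integral_ge0 => [x|x|x _]; try exact: erestrict_ge0.
rewrite /patch; case: ifPn => [|_]; last by case: ifPn.
move=> /set_mem[Dx Nx]; rewrite mem_set//.
by apply: contrapT => fk; apply: Nx; apply: fkN => /(_ Dx).
Qed.

Lemma lipschitz_continuous (R : realType) (V W : normedModType R) (L : R)
    (G : V -> W) : 0 <= L ->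
  (forall v w, `|G v - G w| <= L * `|v - w|) -> continuous G.
Proof.
move=> L0 GL v; apply/cvgrPdist_le => e e0.
have d0 : 0 < e / (L + 1) by rewrite divr_gt0// ltr_wpDl.
have := near_ball v _ d0; apply: filterS => w; rewrite -ball_normE => /ltW vw.
apply: le_trans (GL _ _) _; apply: le_trans (ler_wpM2l L0 vw) _.
by rewrite mulrCA ler_piMr ?(ltW e0)// ler_pdivrMr ?ltr_wpDl// mul1r lerDl.
Qed.

Section UnitFunctional.
Context (R : realType) (V : normedModType R).
Implicit Types (l : V -> R) (u v : V).

(** Elements of the unit ball of the dual of [V], as plain functions. *)
Definition unit_functional l :=
  [/\ forall u v, l (u + v) = l u + l v,
      forall a u, l (a *: u) = a * l u &
      forall u, `|l u| <= `|u|].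

Variable l : V -> R.
Hypothesis ul : unit_functional l.

Lemma functionalD u v : l (u + v) = l u + l v. Proof. by case: ul. Qed.
Lemma functionalZ a u : l (a *: u) = a * l u. Proof. by case: ul. Qed.
Lemma functional0 : l 0 = 0.
Proof. by rewrite -(scale0r (0 : V)) functionalZ mul0r. Qed.
Lemma functionalB u v : l (u - v) = l u - l v.
Proof. by rewrite -(scaleN1r v) functionalD functionalZ mulN1r. Qed.
Lemma functionalN u : l (- u) = - l u.
Proof. by rewrite -(scaleN1r u) functionalZ mulN1r. Qed.
Lemma functional_sum I (r : seq I) (F : I -> V) :
  l (\sum_(i <- r) F i) = \sum_(i <- r) l (F i).
Proof. by apply: (big_morph l functionalD functional0). Qed.
Lemma functional_le u v : `|l u - l v| <= `|u - v|.
Proof. by rewrite -functionalB; case: ul. Qed.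

Lemma functional_continuous : continuous l.
Proof.
apply: (@lipschitz_continuous _ V R^o 1) => // u v; rewrite mul1r.
exact: functional_le.
Qed.

Section Integral.
Context d (T : measurableType d) (mu : {measure set T -> \bar R}).
Variables (D : set T) (mD : measurable D).
Implicit Types (s g : T -> V) (h : T -> R).

Lemma functional_simple s x : vector_simple s ->
  l (s x) = \sum_(v <- fset_set (range s)) l v * \1_(s @^-1` [set v]) x.
Proof.
move=> [fs ms]; have xs : s x \in fset_set (range s).
  by rewrite in_fset_set//; apply/mem_set; exists x.
rewrite (big_fsetD1 (s x))//= indicE mem_set// mulr1 big1_fset ?addr0// => v.
rewrite !inE => /andP[vx _] _; rewrite indicE memNset ?mulr0//= => sx.
by rewrite -sx eqxx in vx.
Qed.

Let integrable_piece s : integrable_simple mu D s -> forall v,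
  mu.-integrable D (fun x => (l v * \1_(s @^-1` [set v]) x)%:E).
Proof.
move=> [[fs ms] sfin] v; have [->|v0] := eqVneq v 0.
  rewrite functional0; under eq_fun do rewrite mul0r.
  exact: integrable0.
under eq_fun do rewrite EFinM.
apply: integrableZl => //.
apply/integrableP; split; first exact/measurable_EFinP/measurable_indic.
under eq_integral do rewrite gee0_abs ?lee_fin//.
by rewrite integral_indic// setIC sfin.
Qed.

Lemma integrable_functional_simple s : integrable_simple mu D s ->
  mu.-integrable D (EFin \o (l \o s)).
Proof.
move=> is_; have [ss _] := is_.
rewrite (_ : _ \o _ = fun x =>
  (\sum_(v <- fset_set (range s)) (l v * \1_(s @^-1` [set v]) x)%:E)%E).
  by apply: integrable_sum => // v _; exact: integrable_piece.
by apply/funext => x /=; rewrite functional_simple// sumEFin.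
Qed.

Lemma functional_simple_integral s : integrable_simple mu D s ->
  \int[mu]_(x in D) l (s x) = l (simple_integral mu D s).
Proof.
move=> is_; have [ss sfin] := is_.
rewrite /simple_integral (fsbigE (fset_set (range s))); last 3 first.
- exact: fset_uniq.
- by move=> v /=; rewrite in_fset_set; [move/set_mem|case: ss].
- by move=> v sv; rewrite /= in_fset_set ?mem_set//; case: ss.
rewrite [X in l X](_ : _ =
  \sum_(v <- fset_set (range s)) fine (mu (D `&` s @^-1` [set v])) *: v); last first.
  rewrite big_seq_cond [RHS]big_seq; apply: eq_bigl => v.
  by rewrite in_fset_set ?andbb//; case: ss.
rewrite functional_sum; under eq_bigr do rewrite functionalZ.
rewrite /Rintegral.
under eq_integral do rewrite functional_simple// -sumEFin.
rewrite integral_sum//; last exact: integrable_piece.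
rewrite (eq_bigr (fun v => (fine (mu (D `&` s @^-1` [set v])) * l v)%:E)) => [|v _].
  by rewrite sumEFin.
have [->|v0] := eqVneq v 0.
  by rewrite functional0 mulr0; under eq_integral do rewrite mul0r; rewrite integral0.
under eq_integral do rewrite EFinM.
have ms v' : measurable (s @^-1` [set v']) by case: ss.
rewrite integralZl// ?integral_indic//.
  by rewrite setIC mulrC EFinM fineK// ge0_fin_numE ?measure_ge0// sfin.
apply/integrableP; split; first exact/measurable_EFinP/measurable_indic.
under eq_integral do rewrite gee0_abs ?lee_fin//.
by rewrite integral_indic// setIC sfin.
Qed.

(** A bounded functional commutes with the Bochner integral: this reduces identities
    between vector-valued integrals to Lebesgue integrals of real functions. *)
Lemma functional_bochner g v h : is_bochner_integral mu D g v ->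
  mu.-integrable D (EFin \o h) ->
  (\forall x \ae mu, D x -> l (g x) = h x) ->
  \int[mu]_(x in D) h x = l v.
Proof.
move=> [_ [s [is_ gs sv]]] ih lgh.
have lim1 : l (simple_integral mu D (s n)) @[n --> \oo] --> l v.
  by apply: continuous_cvg sv; exact: functional_continuous.
have lim2 : l (simple_integral mu D (s n)) @[n --> \oo] --> \int[mu]_(x in D) h x.
  apply/cvgrPdist_lt => e e0.
  have /fine_cvgP[gfin /cvgr0Pnorm_lt/(_ e e0) glt] := gs.
  near=> n; have gfn : (\int[mu]_(x in D) `|g x - s n x|%:E)%E \is a fin_num.
    by near: n.
  have gle : `|fine (\int[mu]_(x in D) `|g x - s n x|%:E)%E| < e by near: n.
  have il := integrable_functional_simple (is_ n).
  have ihl : mu.-integrable D (EFin \o (fun x => h x - l (s n x))).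
    exact: (integrableB mD ih il).
  rewrite -functional_simple_integral// -RintegralB//.
  apply: le_lt_trans (le_normr_Rintegral mD ihl) _.
  apply: le_lt_trans gle; apply: le_trans (ler_norm _).
  rewrite /Rintegral fine_le//.
    apply: integrable_fin_num => //; exact: (integrable_abse ihl).
  apply: ae_le_integral_ge0 => //.
  - by have /integrableP[] := integrable_abse ihl.
  - move: lgh; apply: filterS => x lx Dx.
    by rewrite -lx// lee_fin functional_le.
exact: (cvg_unique _ lim2 lim1).
Unshelve. all: by end_near. Qed.

End Integral.
End UnitFunctional.

(** * Lipschitz curves and their Bochner integrals *)

(** The conclusion of the Hahn-Banach theorem that is needed below. For the space
    of essentially bounded functions it has a direct proof, by averages. *)
Definition norming (R : realType) (V : normedModType R) :=
  forall (w : V) (c : R), c < `|w| -> exists2 l, unit_functional l & c < l w.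

Lemma norming_le (R : realType) (V : normedModType R) (w : V) (c : R) :
  norming V -> (forall l, unit_functional l -> l w <= c) -> `|w| <= c.
Proof.
move=> nV lc; rewrite leNgt; apply/negP => /nV[l ul].
by rewrite ltNge lc.
Qed.

Lemma within_continuous_comp (R : realType) (V W : normedModType R) (A : set R)
    (u : R -> V) (g : V -> W) :
  {within A, continuous u} -> continuous g -> {within A, continuous (g \o u)}.
Proof.
move=> /subspace_continuousP cu cg; apply/subspace_continuousP => x Ax.
by apply: continuous_cvg; [exact: cg|exact: cu].
Qed.

Section Lipschitz.
Context (R : realType) (V : normedModType R).
Local Notation lambda := (@lebesgue_measure R).

Definition lipschitz_on (tau K : R) (f : R -> V) :=
  forall s t, 0 <= s -> s <= t -> t <= tau -> `|f t - f s| <= K * (t - s).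

(** [u] is continuously differentiable with derivative [f], in a quantitative form
    that passes to limits of [u] and of [f] and that refers to no derivative at the
    end points. *)
Definition has_antiderivative (tau C : R) (f u : R -> V) :=
  forall s t, 0 <= s -> s <= t -> t <= tau ->
    `|u t - u s - (t - s) *: f s| <= C * (t - s) ^+ 2.

Lemma lipschitz_on_bound tau K f t : lipschitz_on tau K f -> 0 <= t -> t <= tau ->
  `|f t| <= `|f 0| + `|K| * tau.
Proof.
move=> lf t0 tt; rewrite -(subrK (f 0) (f t)) addrC.
apply: le_trans (ler_normD _ _) _; rewrite lerD2l.
apply: le_trans (lf _ _ (lexx 0) t0 tt) _; rewrite subr0.
by apply: le_trans (ler_wpM2r t0 (ler_norm K)) _; rewrite ler_wpM2l.
Qed.

Lemma bounded_antiderivative_lipschitz tau C M f u :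
  (forall t, 0 <= t -> t <= tau -> `|f t| <= M) -> has_antiderivative tau C f u ->
  lipschitz_on tau (M + `|C| * tau) u.
Proof.
move=> fM fu s t s0 st tt; have t_s : 0 <= t - s by rewrite subr_ge0.
rewrite -(subrK ((t - s) *: f s) (u t - u s)).
apply: le_trans (ler_normD _ _) _; rewrite normrZ (ger0_norm t_s).
have uC : C * (t - s) ^+ 2 <= (t - s) * (`|C| * tau).
  have -> : C * (t - s) ^+ 2 = (t - s) * (C * (t - s)) by ring.
  apply: ler_wpM2l => //.
  apply: le_trans (ler_wpM2r t_s (ler_norm C)) _; rewrite ler_wpM2l//.
  by rewrite lerBlDr (le_trans tt)// lerDl.
have fs : (t - s) * `|f s| <= (t - s) * M.
  by rewrite ler_wpM2l// fM// (le_trans st).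
apply: le_trans (lerD (fu _ _ s0 st tt) fs) _.
by apply: le_trans (lerD uC (lexx _)) _; rewrite -mulrDr mulrC addrC.
Qed.

Lemma antiderivative_lipschitz tau C K f u :
  lipschitz_on tau K f -> has_antiderivative tau C f u ->
  exists B, lipschitz_on tau B u.
Proof.
move=> lf fu; exists (`|f 0| + `|K| * tau + `|C| * tau).
by apply: bounded_antiderivative_lipschitz fu => t; exact: lipschitz_on_bound.
Qed.

Lemma lipschitz_on_comp tau K L (G : V -> V) u : 0 <= L ->
  (forall v w, `|G v - G w| <= L * `|v - w|) -> lipschitz_on tau K u ->
  lipschitz_on tau (L * K) (G \o u).
Proof.
move=> L0 GL lu s t s0 st tt; apply: le_trans (GL _ _) _.
by rewrite -mulrA ler_wpM2l// lu.
Qed.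

Lemma lipschitz_on_continuous tau K f : lipschitz_on tau K f ->
  {within `[0, tau], continuous f}.
Proof.
move=> lf; apply/subspace_continuousP => x; rewrite /= in_itv/= => /andP[x0 xt].
apply/cvgrPdist_le => e e0.
have K0 : 0 < `|K| + 1 by rewrite ltr_wpDl.
have d0 : 0 < e / (`|K| + 1) by rewrite divr_gt0.
rewrite near_withinE; have := near_ball (x : R) _ d0; apply: filterS => y /ltW xy.
rewrite /= in_itv/= => /andP[y0 yt].
suff : `|f x - f y| <= (`|K| + 1) * `|x - y|.
  by move/le_trans; apply; rewrite -ler_pdivlMl// mulrC.
wlog xley : x y x0 y0 xt yt {xy} / x <= y => [H|].
  by have [xley|/ltW ylex] := leP x y; [exact: H|rewrite distrC (distrC x); exact: H].
rewrite distrC (distrC x) (ger0_norm (x := y - x)) ?subr_ge0//.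
apply: le_trans (lf _ _ x0 xley yt) _; apply: ler_wpM2r; first by rewrite subr_ge0.
by rewrite (le_trans (ler_norm _))// lerDl.
Qed.

End Lipschitz.

(** For a Lipschitz [F] the quadratic estimate, based at the left end point, is
    equivalent to one based at the right end point, hence to a derivative. *)
Section ScalarFTC.
Context (R : realType).
Local Notation lambda := (@lebesgue_measure R).
Variables (tau C K : R) (F U : R -> R).
Hypothesis tau0 : 0 < tau.
Hypothesis FU : has_antiderivative (V := R^o) tau C F U.
Hypothesis lF : lipschitz_on (V := R^o) tau K F.

Lemma antiderivative_is_derive x : x \in `]0, tau[ -> is_derive x 1 U (F x).
Proof.
rewrite in_itv/= => /andP[x0 xt].
pose M := `|C| + `|K| + 1.
have M0 : 0 < M by rewrite /M ltr_wpDl// addr_ge0.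
have near_x h : 0 <= x + h -> x + h <= tau -> `|U (x + h) - U x - h * F x| <= M * h ^+ 2.
  move=> xh0 xht; have [h0|h0] := leP 0 h.
    have xle : x <= x + h by rewrite lerDl.
    have := FU (ltW x0) xle xht.
    have -> : x + h - x = h by ring.
    move=> /le_trans; apply.
    apply: ler_wpM2r; first exact: sqr_ge0.
    by rewrite /M -addrA (le_trans (ler_norm _))// lerDl addr_ge0.
  have xle : x + h <= x by rewrite gerDl ltW.
  have := FU xh0 xle (ltW xt); have := lF xh0 xle (ltW xt).
  have -> : x - (x + h) = - h by ring.
  rewrite sqrrN -normrN => FK UC.
  have -> : U (x + h) - U x - h * F x =
    - (U x - U (x + h) - - h *: F (x + h)) + h * - (F x - F (x + h)).
    by rewrite /GRing.scale/=; ring.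
  apply: le_trans (ler_normD _ _) _; rewrite normrN normrM (ltr0_norm h0).
  have FK' : - h * `|- (F x - F (x + h))| <= - h * (K * - h).
    by apply: ler_wpM2l => //; rewrite oppr_ge0 ltW.
  apply: le_trans (lerD UC FK') _; rewrite -subr_ge0 /M.
  have -> : (`|C| + `|K| + 1) * h ^+ 2 - (C * h ^+ 2 + - h * (K * - h)) =
    (`|C| - C + (`|K| - K) + 1) * h ^+ 2 by ring.
  have := ler_norm C; have := ler_norm K => ? ?.
  by apply: mulr_ge0; [lra|exact: sqr_ge0].
have lim : h^-1 *: (U (h *: 1 + x) - U x) @[h --> 0^'] --> F x.
  apply/cvgrPdist_le => e e0; near=> h.
  have hn0 : h != 0 by near: h; exact: nbhs_dnbhs_neq.
  have hx : `|h| <= x by near: h; exact: dnbhs0_le.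
  have hxt : `|h| <= tau - x by near: h; apply: dnbhs0_le; rewrite subr_gt0.
  have he : `|h| <= e / M by near: h; apply: dnbhs0_le; rewrite divr_gt0.
  have [h1 h2] : 0 <= x + h /\ x + h <= tau.
    by move: hx hxt; rewrite !ler_norml => /andP[? ?] /andP[? ?]; split; lra.
  rewrite [h *: 1]mulr1 (addrC h) distrC.
  have -> : h^-1 *: (U (x + h) - U x) - F x = h^-1 * (U (x + h) - U x - h * F x).
    by rewrite /GRing.scale/= [RHS]mulrBr mulrA mulVf// mul1r.
  rewrite normrM normfV ler_pdivrMl ?normr_gt0//.
  apply: le_trans (near_x _ h1 h2) _.
  rewrite -[h ^+ 2]real_normK ?num_real// expr2 mulrCA mulrA.
  rewrite -mulrA ler_wpM2l//.
  by rewrite -ler_pdivlMl// mulrC.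
apply: DeriveDef; first by apply/cvg_ex; exists (F x).
exact: cvg_lim.
Unshelve. all: by end_near. Qed.

Lemma antiderivative_FTC : \int[lambda]_(x in `[0, tau]) F x = U tau - U 0.
Proof.
have [B lU] := antiderivative_lipschitz lF FU.
have cU := lipschitz_on_continuous lU; have cF := lipschitz_on_continuous lF.
have /(continuous_within_itvP _ tau0)[_ U0 Ut] := cU.
rewrite /Rintegral (@continuous_FTC2 _ _ U)//.
- split => // x xt; have d := antiderivative_is_derive xt; exact: ex_derive.
- move=> x xt; rewrite derive1E; have d := antiderivative_is_derive xt.
  exact: derive_val.
Qed.

End ScalarFTC.

Section Grid.
Context (R : realType).

(** The largest multiple of 1/c that is at most t, for nonnegative t. *)
Definition grid (c t : R) : R := (Num.truncn (t * c))%:R / c.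

Lemma grid_bounds c t : 0 < c -> 0 <= t ->
  0 <= grid c t /\ grid c t <= t <= grid c t + c^-1.
Proof.
move=> c0 t0; have tc0 : 0 <= t * c by rewrite mulr_ge0// ltW.
have /andP[g1 g2] := truncn_itv tc0; split; first by rewrite divr_ge0// ltW.
rewrite /grid ler_pdivrMr// g1/= -[X in _ + X]div1r -mulrDl ler_pdivlMr//.
by rewrite natr1 ltW.
Qed.

End Grid.

Section BochnerFTC.
Context (R : realType) (V : normedModType R).
Local Notation lambda := (@lebesgue_measure R).
Variables (tau C K : R) (f u : R -> V).
Hypothesis tau0 : 0 < tau.
Hypothesis lf : lipschitz_on tau K f.

Definition staircase n (t : R) : V := if t \in `[0, tau] then f (grid n.+1%:R t) else 0.

Lemma staircase_close n t : t \in `[0, tau] -> `|f t - staircase n t| <= `|K| * n.+1%:R^-1.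
Proof.
move=> t01; rewrite /staircase t01; move: t01; rewrite in_itv/= => /andP[t0 tt].
have [g0 /andP[gt tg]] := grid_bounds (ltr0Sn R n) t0.
apply: le_trans (lf g0 gt tt) _; apply: le_trans (ler_wpM2r _ (ler_norm K)) _.
  by rewrite subr_ge0.
by rewrite ler_wpM2l// lerBlDl.
Qed.

Lemma staircase_measurable n (v : V) : measurable (staircase n @^-1` [set v]).
Proof.
have n0 : 0 < n.+1%:R :> R by rewrite ltr0n.
pose piece k := `[k%:R / n.+1%:R, k.+1%:R / n.+1%:R[%classic : set R.
have pieceP t k : 0 <= t -> piece k t <-> Num.truncn (t * n.+1%:R) = k.
  move=> t0; have tn0 : 0 <= t * n.+1%:R by rewrite mulr_ge0// ltW.
  rewrite /piece /= in_itv/= ler_pdivrMr// ltr_pdivlMr//; split=> [|<-].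
    exact: truncn_def.
  exact: truncn_itv.
pose B := [set k : nat | f (k%:R / n.+1%:R) = v].
rewrite (_ : _ @^-1` _ = (`[0, tau]%classic `&` \bigcup_(k in B) piece k) `|`
    (~` `[0, tau]%classic `&` (if v == 0 then setT else set0))).
  apply: measurableU; apply: measurableI => //.
  - by apply: bigcup_measurable => k _; exact: measurable_itv.
  - exact: measurableC.
  - by case: ifP.
apply/seteqP; split=> t /=; rewrite /staircase.
  case: ifPn => [t01 ft|t01 <-]; last by right; rewrite eqxx; split => //; exact/negP.
  left; split => //; have t0 : 0 <= t by move: t01; rewrite in_itv/= => /andP[].
  by exists (Num.truncn (t * n.+1%:R)) => //; apply/pieceP.
case=> -[t01].
  rewrite t01 => -[k Bk]; have t0 : 0 <= t by move: t01; rewrite in_itv/= => /andP[].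
  by move=> /(pieceP _ _ t0); rewrite /grid => ->.
by move/negP/negbTE : t01 => ->; case: eqP.
Qed.

Lemma staircase_simple n : vector_simple (staircase n).
Proof.
split; last exact: staircase_measurable.
have n0 : 0 < n.+1%:R :> R by rewrite ltr0n.
pose N := (Num.truncn (tau * n.+1%:R)).+1.
apply: (@sub_finite_set _ _
    ([set 0] `|` [set f (k%:R / n.+1%:R) | k in `I_N])); last first.
  by rewrite finite_setU; split; [exact: finite_set1|exact/finite_image/finite_II].
move=> _ [t _ <-]; rewrite /staircase; case: ifPn => t01; last by left.
right; exists (Num.truncn (t * n.+1%:R)) => //=.
move: t01; rewrite in_itv/= ltnS => /andP[t0 tt].
by rewrite truncn_le_nat (le_lt_trans _ (truncnS_gt _))// ler_pM2r.
Qed.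

Lemma staircase_integrable n : integrable_simple lambda `[0, tau] (staircase n).
Proof.
split; first exact: staircase_simple.
move=> v _; apply: (@le_lt_trans _ _ (lambda `[0, tau])).
  apply: le_measure => //; apply/mem_set; last exact: measurable_itv.
  by apply: measurableI; [exact: measurable_itv|exact: staircase_measurable].
by rewrite lebesgue_measure_itv/= lte_fin tau0 sube0 ltry.
Qed.

Lemma grid_error_cvg0 : `|K| * n.+1%:R^-1 @[n --> \oo] --> (0 : R).
Proof. by rewrite -(mulr0 `|K|); apply: cvgM; [exact: cvg_cst|exact: cvg_harmonic]. Qed.

Lemma lipschitz_strongly_measurable : strongly_measurable lambda `[0, tau] f.
Proof.
exists staircase; split; first exact: staircase_simple.
apply: aeW => t /= t01; apply/cvgrPdist_le => e e0; near=> n.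
apply: le_trans (staircase_close n t01) _; rewrite -[leLHS]ger0_norm ?mulr_ge0//.
near: n; move: e e0; apply/cvgr0Pnorm_le; exact: grid_error_cvg0.
Unshelve. all: by end_near. Qed.

Hypothesis nV : norming V.
Hypothesis fu : has_antiderivative tau C f u.

(** The values of [f] at the points k/(n+1) give simple functions at distance at
    most K/(n+1) from [f]. To see that their integrals converge to the increment of
    [u], it is enough to compare their images under each functional [l] with the
    increment of [l \o u], which the fundamental theorem expresses as the integral
    of [l \o f]: no Riemann sum is ever computed. *)
Lemma lipschitz_bochner_integral :
  is_bochner_integral lambda `[0, tau] f (u tau - u 0).
Proof.
split; first exact: lipschitz_strongly_measurable.
have len : lambda `[0, tau] = tau%:E by rewrite lebesgue_measure_itv/= lte_fin tau0 sube0.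
have lim0 : `|K| * n.+1%:R^-1 * tau @[n --> \oo] --> (0 : R).
  by rewrite -(mul0r tau); apply: cvgM; [exact: grid_error_cvg0|exact: cvg_cst].
exists staircase; split; first exact: staircase_integrable.
  apply: (@squeeze_cvge _ _ _ _ (cst 0%E) _ (fun n => (`|K| * n.+1%:R^-1 * tau)%:E)).
  - near=> n; rewrite integral_ge0 => [|x _]; last by rewrite lee_fin.
    have -> : (`|K| * n.+1%:R^-1 * tau)%:E =
        (\int[lambda]_(x in `[0%R, tau]) (`|K| * n.+1%:R^-1)%:E)%E.
      by rewrite integral_cst//= len EFinM.
    apply: le_integral_ge0 => [x|x|x]; rewrite lee_fin ?mulr_ge0//.
    exact: staircase_close.
  - exact: cvg_cst.
  - by apply/fine_cvgP; split; [exact: nearW|exact: lim0].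
apply/cvgrPdist_le => e e0; near=> n.
have small : `|K| * n.+1%:R^-1 * tau <= e.
  rewrite -[leLHS]ger0_norm ?mulr_ge0 ?(ltW tau0)//.
  by near: n; move: e e0; apply/cvgr0Pnorm_le.
rewrite distrC; apply: norming_le => // l ul; rewrite !(functionalB ul).
have := functional_simple_integral (mu := lambda) ul (measurable_itv `[0, tau]) (staircase_integrable n).
move=> <-.
have lfl : lipschitz_on (V := R^o) tau K (l \o f).
  by move=> s t s0 st tt; apply: le_trans (lf s0 st tt); exact: (functional_le ul).
have lfu : has_antiderivative (V := R^o) tau C (l \o f) (l \o u).
  move=> s t s0 st tt; apply: le_trans (fu s0 st tt).
  have -> : (l \o u) t - (l \o u) s - (t - s) *: (l \o f) s = l (u t - u s - (t - s) *: f s).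
    by rewrite !(functionalB ul) (functionalZ ul).
  by case: ul.
rewrite -(antiderivative_FTC tau0 lfu lfl).
have il := integrable_functional_simple (mu := lambda) ul (measurable_itv `[0, tau]) (staircase_integrable n).
have iF := continuous_integrable (lipschitz_on_continuous lfl).
rewrite -RintegralB//.
apply: le_trans (ler_norm _) _.
have id := integrableB (mu := lambda) (measurable_itv `[0, tau]) il iF.
apply: le_trans (le_normr_Rintegral _ id) _ => //.
apply: le_trans small; rewrite -[X in _ * X]/(fine tau%:E) -len -Rintegral_cst//.
apply: le_Rintegral => //.
- exact: (integrable_abse id).
- apply/continuous_integrable/continuous_subspaceT; exact: cst_continuous.
- move=> t t01; apply: le_trans (staircase_close n t01).
  by rewrite distrC; exact: (functional_le ul).
Unshelve. all: by end_near. Qed.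

End BochnerFTC.

(** * Euler's scheme for a bounded Lipschitz vector field *)

Definition fast_cauchy_complete (R : realType) (V : normedModType R) :=
  forall (v : nat -> V) (C : R),
    (forall n, `|v n.+1 - v n| <= C * 2^-1 ^+ n) -> cvg (v @ \oo).

Section Euler.
Context (R : realType) (V : normedModType R).
Variables (F : R -> V -> V) (M L : R).
Hypothesis F_bound : forall t v, `|F t v| <= M.
Hypothesis F_lip : forall s t v w, `|F t v - F s w| <= L * (`|t - s| + `|v - w|).
Hypothesis L0 : 0 <= L.
Variable u0 : V.

Let A := L * (1 + M).

Let M0 : 0 <= M. Proof. exact: le_trans (normr_ge0 _) (F_bound 0 0). Qed.
Let A0 : 0 <= A. Proof. by rewrite mulr_ge0// addr_ge0. Qed.

Fixpoint euler (h : R) (k : nat) : V :=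
  if k is j.+1 then euler h j + h *: F (j%:R * h) (euler h j) else u0.

Lemma euler_lipschitz h k j : 0 <= h -> `|euler h (k + j) - euler h k| <= (j%:R * h) * M.
Proof.
move=> h0; elim: j => [|j IH]; first by rewrite addn0 subrr normr0 !mul0r.
rewrite addnS /= addrAC; apply: le_trans (ler_normD _ _) _.
rewrite -natr1 mulrDl mul1r mulrDl lerD// normrZ ger0_norm//.
by rewrite ler_wpM2l.
Qed.

(** One long tangent step from k agrees with j Euler steps to second order, with a
    constant that does not depend on h. *)
Lemma euler_tangent h k j : 0 <= h ->
  `|euler h (k + j) - euler h k - (j%:R * h) *: F (k%:R * h) (euler h k)|
    <= A * (j%:R * h) ^+ 2.
Proof.
move=> h0; elim: j => [|j IH].
  by rewrite addn0 subrr !mul0r scale0r subrr normr0 expr0n mulr0.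
pose Fk := F (k%:R * h) (euler h k).
pose Fj := F ((k + j)%:R * h) (euler h (k + j)).
have -> : euler h (k + j.+1) - euler h k - (j.+1%:R * h) *: Fk =
    (euler h (k + j) - euler h k - (j%:R * h) *: Fk) + h *: (Fj - Fk).
  rewrite addnS /= -/Fj -natr1 mulrDl mul1r scalerDl scalerBr opprD.
  by rewrite !addrA (addrAC _ (h *: Fj)) (addrAC _ (h *: Fj) (- (_ *: Fk))).
have jh0 : 0 <= j%:R * h by rewrite mulr_ge0.
have FjFk : `|Fj - Fk| <= A * (j%:R * h).
  apply: le_trans (F_lip _ _ _ _) _; rewrite /A -mulrA ler_wpM2l//.
  have -> : (k + j)%:R * h - k%:R * h = j%:R * h by rewrite natrD; ring.
  rewrite ger0_norm// mulrDl mul1r lerD2l mulrC; exact: euler_lipschitz.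
apply: le_trans (ler_normD _ _) _; rewrite normrZ (ger0_norm h0).
have hF : h * `|Fj - Fk| <= h * (A * (j%:R * h)) by rewrite ler_wpM2l.
apply: le_trans (lerD IH hF) _; rewrite -natr1 -subr_ge0.
have -> : A * ((j%:R + 1) * h) ^+ 2 - (A * (j%:R * h) ^+ 2 + h * (A * (j%:R * h)))
  = A * h ^+ 2 * (j%:R + 1) by ring.
by rewrite mulr_ge0 ?mulr_ge0 ?sqr_ge0// addr_ge0.
Qed.

(** Halving the step perturbs each step by O(h^2); the perturbations accumulate
    through the factor (1 + 2 h L) by which a step can expand distances. *)
Lemma euler_refine h k : 0 <= h ->
  `|euler h (k.*2) - euler (2 * h) k| <= A * h ^+ 2 * k%:R * (1 + 2 * h * L) ^+ k.
Proof.
move=> h0; elim: k => [|k IH]; first by rewrite subrr normr0 mulr0 mul0r.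
pose v := euler h k.*2; pose w := euler (2 * h) k; rewrite -/v -/w in IH.
pose Fv := F (k%:R * (2 * h)) v; pose Fw := F (k%:R * (2 * h)) w.
pose Fv' := F (k%:R * (2 * h) + h) (v + h *: Fv).
have -> : euler h (k.+1).*2 - euler (2 * h) k.+1 =
    (v - w) + ((2 * h) *: (Fv - Fw) + h *: (Fv' - Fv)).
  have kk : k.*2%:R * h = k%:R * (2 * h) by rewrite -muln2 natrM mulrA.
  rewrite doubleS /= -/v -/w -/Fw -natr1 mulrDl mul1r kk -/Fv -/Fv'.
  rewrite !scalerBr mulr_natl mulr2n !scalerDl.
  move: (h *: Fv) (h *: Fv') (h *: Fw) => b c d.
  rewrite (addrC c) !opprD !addrA (addrAC _ (- d) (- b)).
  rewrite (addrAC _ (- d) (- b)) addrK.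
  by rewrite (addrAC _ c) (addrAC v) (addrAC _ c (- d)) (addrAC _ c (- d)).
have FvFw : `|Fv - Fw| <= L * `|v - w|.
  by apply: le_trans (F_lip _ _ _ _) _; rewrite subrr normr0 add0r.
have Fv'Fv : `|Fv' - Fv| <= A * h.
  apply: le_trans (F_lip _ _ _ _) _; rewrite /A -mulrA ler_wpM2l//.
  have -> : k%:R * (2 * h) + h - k%:R * (2 * h) = h by ring.
  rewrite (addrC v) addrK normrZ (ger0_norm h0) mulrDl mul1r.
  by rewrite lerD2l mulrC ler_wpM2r// F_bound.
apply: le_trans (ler_normD _ _) _.
have h2 : `|(2 * h) *: (Fv - Fw) + h *: (Fv' - Fv)| <=
    2 * h * (L * `|v - w|) + h * (A * h).
  apply: le_trans (ler_normD _ _) _; rewrite !normrZ (ger0_norm h0) ger0_norm ?mulr_ge0//.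
  by apply: lerD; rewrite ler_wpM2l// mulr_ge0.
apply: le_trans (lerD (lexx _) h2) _.
have q0 : 0 <= 2 * h * L by rewrite !mulr_ge0.
have step : (1 + 2 * h * L) * `|v - w| <=
    (1 + 2 * h * L) * (A * h ^+ 2 * k%:R * (1 + 2 * h * L) ^+ k).
  by rewrite ler_wpM2l// addr_ge0.
have -> : `|v - w| + (2 * h * (L * `|v - w|) + h * (A * h)) =
  (1 + 2 * h * L) * `|v - w| + A * h ^+ 2 by ring.
apply: le_trans (lerD step (lexx _)) _.
have q1 : 1 <= (1 + 2 * h * L) ^+ k.+1 by rewrite exprn_ege1// lerDl.
have Ah : A * h ^+ 2 <= A * h ^+ 2 * (1 + 2 * h * L) ^+ k.+1.
  by rewrite ler_peMr// mulr_ge0// sqr_ge0.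
apply: le_trans (lerD (lexx _) Ah) _; rewrite le_eqVlt; apply/orP; left.
by apply/eqP; rewrite (exprS (1 + 2 * h * L) k) -(natr1 k); ring.
Qed.

Hypothesis complete : fast_cauchy_complete V.

Let dt n : R := 2^-1 ^+ n.

Let dt0 n : 0 < dt n. Proof. by rewrite exprn_gt0// invr_gt0. Qed.

Let dtV n : (dt n)^-1 = 2 ^+ n. Proof. by rewrite /dt exprVn invrK. Qed.

(** The step is 2^(-n), and the iterate at the dyadic point below t is used. *)
Definition euler_approx n (t : R) : V := euler (dt n) (Num.truncn (t * 2 ^+ n)).

Lemma euler_approx_cauchy t : 0 <= t -> exists C, forall n,
  `|euler_approx n.+1 t - euler_approx n t| <= C * 2^-1 ^+ n.
Proof.
move=> t0; exists (M + A * t * expR (L * t)) => n.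
have tn0 : 0 <= t * 2 ^+ n by rewrite mulr_ge0// exprn_ge0.
pose k := Num.truncn (t * 2 ^+ n).
have /andP[k1 k2] := truncn_itv tn0; rewrite -/k in k1 k2.
(* On the grid of step 2^(-n-1), the point below t is 2k or 2k + 1. *)
have [j j1 kj] : exists2 j, (j <= 1)%N & Num.truncn (t * 2 ^+ n.+1) = (k.*2 + j)%N.
  rewrite exprS mulrCA; set z := t * 2 ^+ n in tn0 k1 k2 *.
  have [zk|zk] := ltP z (k%:R + 2^-1).
    exists 0%N => //; rewrite addn0; apply: truncn_def.
    by rewrite -natr1 -muln2 natrM; lra.
  exists 1%N => //; apply: truncn_def; move: k2; rewrite -!natr1 natrD -muln2 natrM; lra.
have -> : euler_approx n.+1 t - euler_approx n t =
    (euler (dt n.+1) (k.*2 + j) - euler (dt n.+1) k.*2) +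
    (euler (dt n.+1) k.*2 - euler (2 * dt n.+1) k).
  rewrite /euler_approx kj -/k addrA subrK; congr (_ - euler _ _).
  by rewrite /dt exprS mulrA mulfV// mul1r.
apply: le_trans (ler_normD _ _) _; rewrite [leRHS]mulrDl; apply: lerD.
  apply: le_trans (euler_lipschitz _ _ (ltW (dt0 _))) _; rewrite mulrC ler_wpM2l//.
  apply: (@le_trans _ _ (1 * dt n.+1)).
    by rewrite ler_wpM2r ?ler1n// ?(ltW (dt0 _))// -[1]/(1%:R) ler_nat.
  by rewrite mul1r /dt exprS; apply: ler_piMl; [exact: ltW (dt0 n)|lra].
apply: le_trans (euler_refine _ (ltW (dt0 _))) _.
have kt : k%:R * dt n <= t by rewrite -ler_pdivlMr// dtV.
have h2 : 2 * dt n.+1 = dt n by rewrite /dt exprS mulrA mulfV// mul1r.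
have pow : (1 + 2 * dt n.+1 * L) ^+ k <= expR (L * t).
  rewrite h2; apply: (@le_trans _ _ (expR (dt n * L) ^+ k)).
    apply: lerXn2r; rewrite ?nnegrE ?expR_ge0 ?expR_ge1Dx//.
    by rewrite addr_ge0// mulr_ge0// ltW.
  rewrite -expRM_natl ler_expR.
  have -> : k%:R * (dt n * L) = L * (k%:R * dt n) by ring.
  exact: ler_wpM2l.
have pow0 : 0 <= (1 + 2 * dt n.+1 * L) ^+ k.
  by rewrite exprn_ge0// addr_ge0// mulr_ge0// h2 ltW.
have fac : A * dt n.+1 ^+ 2 * k%:R <= A * t * dt n.
  have -> : A * dt n.+1 ^+ 2 * k%:R = A * (k%:R * dt n * dt n / 4).
    by rewrite -h2; field.
  have -> : A * t * dt n = A * (t * dt n) by ring.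
  apply: ler_wpM2l => //.
  have : k%:R * dt n * dt n <= t * dt n by rewrite ler_wpM2r// ltW.
  have : 0 <= k%:R * dt n * dt n by rewrite !mulr_ge0// ltW.
  lra.
rewrite [leRHS]mulrAC; apply: ler_pM => //.
  apply: mulr_ge0 => //; apply: mulr_ge0 => //; exact: sqr_ge0.
Qed.

Definition solution (t : R) : V := lim (euler_approx n t @[n --> \oo]).

Lemma solution_cvg t : 0 <= t -> euler_approx n t @[n --> \oo] --> solution t.
Proof. by move=> /euler_approx_cauchy[C /complete]. Qed.

Lemma solution_initial : solution 0 = u0.
Proof.
rewrite /solution; apply: cvg_lim => //.
rewrite (_ : (fun n => _) = cst u0); first exact: cvg_cst.
by apply/funext => n; rewrite /euler_approx mul0r truncn0.
Qed.

Lemma dyadic_cvg (t : R) : 0 <= t -> grid (2 ^+ n) t @[n --> \oo] --> t.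
Proof.
move=> t0; apply: (@squeeze_cvgr _ _ _ _ (fun n => t - dt n) (cst t)).
- apply: nearW => n.
  have [_ /andP[h1 h2]] := grid_bounds (exprn_gt0 n (ltr0Sn R 1)) t0.
  by rewrite h1 andbT lerBlDr; move: h2; rewrite -exprVn.
- rewrite -[X in _ --> X]subr0; apply: cvgB; first exact: cvg_cst.
  by apply: cvg_expr; rewrite ger0_norm; lra.
- exact: cvg_cst.
Qed.

(** The limit in [euler_tangent]. The constant is global in time, so the curve
    solves the differential equation on the whole half line at once. *)
Lemma solution_antiderivative s t : 0 <= s -> s <= t ->
  `|solution t - solution s - (t - s) *: F s (solution s)| <= A * (t - s) ^+ 2.
Proof.
move=> s0 st; have t0 := le_trans s0 st.
have cs := solution_cvg s0; have ct := solution_cvg t0.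
have ds := dyadic_cvg s0; have dt' := dyadic_cvg t0.
have cF : F (grid (2 ^+ n) s) (euler_approx n s) @[n --> \oo] --> F s (solution s).
  apply/cvgrPdist_le => e e0.
  have e' : 0 < e / (L + 1) / 2 by rewrite !divr_gt0// ltr_wpDl.
  have N1 : \forall n \near \oo, `|s - grid (2 ^+ n) s| <= e / (L + 1) / 2.
    by move/cvgrPdist_le : ds; apply.
  have N2 : \forall n \near \oo, `|solution s - euler_approx n s| <= e / (L + 1) / 2.
    by move/cvgrPdist_le : cs; apply.
  near=> n; apply: le_trans (F_lip _ _ _ _) _.
  have h1 : `|s - grid (2 ^+ n) s| <= e / (L + 1) / 2.
    by near: n.
  have h2 : `|solution s - euler_approx n s| <= e / (L + 1) / 2.
    by near: n.
  have h3 : `|s - grid (2 ^+ n) s| + `|solution s - euler_approx n s| <= e / (L + 1) by lra.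
  apply: le_trans (ler_wpM2l L0 h3) _.
  rewrite mulrCA ler_piMr ?(ltW e0)// ler_pdivrMr ?ltr_wpDl// mul1r lerDl//.
have lhs : `|euler_approx n t - euler_approx n s -
    (grid (2 ^+ n) t - grid (2 ^+ n) s) *: F (grid (2 ^+ n) s) (euler_approx n s)|
    @[n --> \oo] --> `|solution t - solution s - (t - s) *: F s (solution s)|.
  apply: cvg_norm; apply: cvgB; first exact: cvgB.
  by apply: cvgZ => //; exact: cvgB.
have rhs : A * (grid (2 ^+ n) t - grid (2 ^+ n) s) ^+ 2 @[n --> \oo] --> A * (t - s) ^+ 2.
  apply: cvgM; first exact: cvg_cst.
  by rewrite expr2; under eq_fun do rewrite expr2; apply: cvgM; exact: cvgB.
apply: (ler_cvg_to lhs rhs); apply: nearW => n.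
have n0 : 0 < 2 ^+ n :> R by rewrite exprn_gt0.
pose k := Num.truncn (s * 2 ^+ n); pose l := Num.truncn (t * 2 ^+ n).
have kl : (k <= l)%N by apply: le_truncn; rewrite ler_wpM2r// ltW.
have gE x : grid (2 ^+ n) x = (Num.truncn (x * 2 ^+ n))%:R * dt n.
  by rewrite /grid /dt exprVn.
have := euler_tangent k (l - k) (ltW (dt0 n)).
rewrite subnKC// natrB// mulrBl.
by rewrite /euler_approx !gE.
Unshelve. all: by end_near. Qed.

End Euler.

(** * The Banach space of essentially bounded functions *)

Lemma fast_cauchy_dist (R : realType) (V : normedModType R) (v : nat -> V) (C : R) :
  (forall n, `|v n.+1 - v n| <= C * 2^-1 ^+ n) ->
  forall n j, `|v (n + j)%N - v n| <= 2 * C * 2^-1 ^+ n.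
Proof.
move=> vC n j; have C0 : 0 <= C.
  by have := vC 0%N; rewrite expr0 mulr1; apply: le_trans.
have h0 k : 0 <= (2^-1 : R) ^+ k by rewrite exprn_ge0// invr_ge0.
suff : `|v (n + j)%N - v n| <= 2 * C * 2^-1 ^+ n - 2 * C * 2^-1 ^+ (n + j).
  by move/le_trans; apply; rewrite lerBlDr lerDl !mulr_ge0.
elim: j => [|j IH]; first by rewrite addn0 !subrr normr0.
rewrite addnS -(subrK (v (n + j)%N) (v (n + j).+1)) -addrA.
apply: le_trans (ler_normD _ _) _; apply: le_trans (lerD (vC _) IH) _.
have := h0 (n + j)%N; rewrite exprS; lra.
Qed.

Lemma complete_fast_cauchy (R : realType) (V : completeNormedModType R) :
  fast_cauchy_complete V.
Proof.
move=> v C vC; have C0 : 0 <= C.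
  by have := vC 0%N; rewrite expr0 mulr1; apply: le_trans.
have : cvgn (series (fun n => v n.+1 - v n)).
  apply: normed_cvg; have gcv : cvgn (series (geometric C (2^-1))).
    by apply: is_cvg_geometric_series; rewrite ger0_norm; lra.
  apply: series_le_cvg gcv => n //=.
  by rewrite mulr_ge0// exprn_ge0// invr_ge0.
move=> /cvg_ex[l sl]; apply/cvg_ex; exists (l + v 0%N).
have vE : (fun n => series (fun n => v n.+1 - v n) n + v 0%N) = v.
  by apply/funext => n; rewrite /series/= telescope_sumr// subrK.
by rewrite -[X in X @ _]vE; apply: cvgD => //; exact: cvg_cst.
Qed.

Lemma ae_bounded_integrable d (T : measurableType d) (R : realType)
    (mu : {measure set T -> \bar R}) (D : set T) (f : T -> R) (C : R) :
  measurable D -> (mu D < +oo)%E -> measurable_fun D f ->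
  (\forall x \ae mu, D x -> `|f x| <= C) ->
  mu.-integrable D (EFin \o f) /\ `|\int[mu]_(x in D) f x| <= C * fine (mu D).
Proof.
move=> mD Dfin mf fC; have mf' : measurable_fun D (EFin \o f) by exact/measurable_EFinP.
pose C' := Num.max C 0.
have C'0 : 0 <= C' by rewrite le_max lexx orbT.
have bound : (\int[mu]_(x in D) `|(EFin \o f) x| <= C'%:E * mu D)%E.
  apply: integral_le_bound => //; move: fC; apply: filterS => x fx Dx.
  by rewrite lee_fin le_max fx.
have intf : mu.-integrable D (EFin \o f).
  apply/integrableP; split => //; apply: le_lt_trans bound _.
  by rewrite lte_mul_pinfty.
split => //.
have muD : mu D \is a fin_num by rewrite ge0_fin_numE// measure_ge0.
have [C0|C0] := leP 0 C.
  rewrite -lee_fin EFin_normr_Rintegral// (le_trans (le_abse_integral _ _ _))//.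
  by rewrite (le_trans bound)// EFinM fineK// /C' max_l.
have D0 : mu D = 0%E.
  case: fC => N [mN N0 fN]; apply: (subset_measure0 mD mN) => // x Dx.
  by apply: fN => /(_ Dx); rewrite leNgt (lt_le_trans C0).
rewrite -lee_fin EFin_normr_Rintegral// (le_trans (le_abse_integral _ _ _))//.
by rewrite (le_trans bound)// D0 mule0 mulr0.
Qed.

Section LinftyTheory.
Context d (T : measurableType d) (R : realType).
Variable mu : {measure set T -> \bar R}.
Local Notation Lf := (Linfty mu).
Implicit Types (u v : Lf).

Lemma Linfty_measurable u : measurable_fun setT (u : T -> R).
Proof. exact: measurable_funP. Qed.

Lemma Linfty_eqP u v : u = v <-> (u : T -> R) = v %[ae mu].
Proof.
rewrite -[in X in X <-> _](reprK u) -[in X in X <-> _](reprK v).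
exact: pi_LinftyP.
Qed.

Lemma Linfty_addE u v : \forall x \ae mu, (u + v : Lf) x = u x + v x.
Proof.
have := repr_pi_Linfty (repr u + repr v); rewrite pi_addr !reprK.
by apply: filterS => x /(_ I).
Qed.

Lemma Linfty_scaleE (a : R) u : \forall x \ae mu, (a *: u : Lf) x = a * u x.
Proof.
by have := repr_pi_Linfty (a *: repr u); apply: filterS => x /(_ I).
Qed.

Lemma Linfty_subE u v : \forall x \ae mu, (u - v : Lf) x = u x - v x.
Proof.
have h1 := Linfty_addE u (- v); have := Linfty_scaleE (-1) v.
move: h1; apply: filterS2 => x ->; rewrite scaleN1r => ->.
by rewrite mulN1r.
Qed.

Lemma Linfty_ae_le u : \forall x \ae mu, `|u x| <= `|u|.
Proof.
have : (\forall x \ae mu, (`|u x|%:E <= 'N[mu]_+oo[EFin \o u])%E).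
  rewrite unlock; case: ifPn => [_|mu0]; first exact: (ess_sup_ge mu (abse \o (EFin \o u))).
  exists setT; split => //.
  by apply/eqP; rewrite eq_le measure_ge0 andbT leNgt.
apply: filterS => x; rewrite -lee_fin => /le_trans; apply.
rewrite /Num.norm/= /norm_Linfty fineK// ge0_fin_numE ?Lnorm_ge0//.
exact: (@Lfunction_finite _ _ _ _ _ _ (repr u)).
Qed.

Lemma Linfty_norm_le u (C : R) : 0 <= C -> (\forall x \ae mu, `|u x| <= C) -> `|u| <= C.
Proof.
move=> C0 uC; rewrite /Num.norm/= /norm_Linfty unlock; case: ifPn => mu0 //.
have h : (ess_sup mu (abse \o (EFin \o u)) <= C%:E)%E.
  by apply/ess_supP; apply: filterS uC => x; rewrite lee_fin.
rewrite -lee_fin fineK// ge0_fin_numE; first exact: le_lt_trans h (ltry _).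
by apply: ess_sup_gee => //; apply: nearW => x /=; rewrite lee_fin.
Qed.

(** The class of [f] when [f] is measurable and essentially bounded. *)
Definition Linfty_of (f : T -> R) : Lf := xget 0 [set u : Lf | (u : T -> R) = f %[ae mu]].

Lemma Linfty_ofE (f : T -> R) (C : R) : measurable_fun setT f ->
  (\forall x \ae mu, `|f x| <= C) -> \forall x \ae mu, Linfty_of f x = f x.
Proof.
move=> mf fC; suff : exists u : Lf, (u : T -> R) = f %[ae mu].
  case=> u uf; have : [set u : Lf | (u : T -> R) = f %[ae mu]] (Linfty_of f).
    by apply: xgetPex; exists u.
  by move=> /=; apply: filterS => x /(_ I).
have fn : finite_norm mu +oo%E f.
  rewrite /finite_norm unlock; case: ifPn => // _.
  apply: (@le_lt_trans _ _ C%:E); last exact: ltry.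
  by apply/ess_supP; move: fC; apply: filterS => x; rewrite lee_fin.
have fL : f \in Lfun mu +oo%E by rewrite inE; apply/andP; split; apply/mem_set.
exists (\pi_(Linfty mu) (Lfun_Sub (one_le_infty R) fL))%qT.
exact: repr_pi_Linfty.
Qed.

(** Outside a null set [N] all the increments v (n+1) - v n are bounded by their
    norms, so the representatives converge uniformly there; setting them to 0 on
    [N] makes the pointwise limit measurable and bounded everywhere. *)
Lemma Linfty_complete : fast_cauchy_complete Lf.
Proof.
rewrite /fast_cauchy_complete -[NormedModule.sort _]/Lf => v C vC; have C0 : 0 <= C.
  by have := vC 0%N; rewrite expr0 mulr1; apply: le_trans.
have : \forall x \ae mu, (forall n, `|v n.+1 x - v n x| <= C * 2^-1 ^+ n) /\ `|v 0%N x| <= `|v 0%N|.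
  have h1 : \forall x \ae mu, forall n, `|v n.+1 x - v n x| <= C * 2^-1 ^+ n.
    apply: ae_foralln => n; have := Linfty_ae_le (v n.+1 - v n).
    have := Linfty_subE (v n.+1) (v n); apply: filterS2 => x -> /le_trans; apply.
    exact: vC.
  by move: h1 (Linfty_ae_le (v 0%N)); apply: filterS2.
move=> [N [mN muN vN]].
pose g n x := if x \in N then 0 else v n x.
have vN' x : x \notin N -> (forall n, `|v n.+1 x - v n x| <= C * 2^-1 ^+ n) /\ `|v 0%N x| <= `|v 0%N|.
  by move=> xN; apply: contrapT => vx; move/negP: xN; apply; apply/mem_set/vN.
have g_fast x n : `|g n.+1 x - g n x| <= C * 2^-1 ^+ n.
  rewrite /g; case: ifPn => [_|/vN'[]//].
  by rewrite subrr normr0 mulr_ge0// exprn_ge0// invr_ge0.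
have g0 x : `|g 0%N x| <= `|v 0%N|.
  by rewrite /g; case: ifPn => [_|/vN'[]//]; rewrite normr0.
have gm n : measurable_fun setT (g n).
  apply: measurable_fun_if => //.
  - apply: (measurable_fun_bool true); rewrite setTI.
    rewrite (_ : _ @^-1` _ = N)//; apply/seteqP; split=> x /=; first by move/set_mem.
    by move/mem_set.
  - exact: measurable_funTS (Linfty_measurable _).
pose f x := lim (g n x @[n --> \oo]).
have gf x : g n x @[n --> \oo] --> f x.
  exact: (@complete_fast_cauchy _ R^o _ _ (g_fast x)).
have fm : measurable_fun setT f by apply: measurable_fun_cvg gm _.
have fg x n : `|f x - g n x| <= 2 * C * 2^-1 ^+ n.
  have lim : `|g (n + j)%N x - g n x| @[j --> \oo] --> `|f x - g n x|.
    apply: cvg_norm; apply: cvgB; last exact: cvg_cst.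
    have := gf x; rewrite -(cvg_shiftn n) => gn.
    rewrite (_ : (fun j => _) = [sequence g (j + n)%N x]_j)//.
    by apply/funext => j; rewrite addnC.
  apply: (ler_cvg_to lim (cvg_cst (2 * C * 2^-1 ^+ n))); apply: nearW => j.
  exact: (@fast_cauchy_dist _ R^o (fun n => g n x)).
have fb x : `|f x| <= `|v 0%N| + 2 * C.
  rewrite -(subrK (g 0%N x) (f x)) addrC; apply: le_trans (ler_normD _ _) _.
  by apply: lerD => //; have := fg x 0%N; rewrite expr0 mulr1.
have fE : \forall x \ae mu, Linfty_of f x = f x.
  by apply: (Linfty_ofE fm (C := `|v 0%N| + 2 * C)); exact: aeW.
apply/cvg_ex; exists (Linfty_of f); apply/cvgrPdist_le => e e0.
have small : 2 * C * 2^-1 ^+ n @[n --> \oo] --> (0 : R).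
  rewrite -(mulr0 (2 * C)); apply: cvgM; first exact: cvg_cst.
  by apply: cvg_expr; rewrite ger0_norm; lra.
near=> n.
have C2n : 2 * C * 2^-1 ^+ n <= e.
  rewrite -[leLHS]ger0_norm; last by rewrite !mulr_ge0// exprn_ge0// invr_ge0.
  by near: n; move: e e0; apply/cvgr0Pnorm_le.
apply: Linfty_norm_le; first exact: ltW.
have subE := Linfty_subE (Linfty_of f) (v n).
have notN : \forall x \ae mu, x \notin N.
  exists N; split => // x /= /negP; rewrite negbK; exact: set_mem.
near=> x.
have -> : (Linfty_of f - v n : Lf) x = Linfty_of f x - v n x by near: x.
have -> : Linfty_of f x = f x by near: x.
have xN : x \notin N by near: x.
by apply: le_trans C2n; apply: le_trans (fg x n); rewrite /g (negbTE xN).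
Unshelve. all: by end_near. Qed.

(** If c' < |w|, one of the sets where w > c' and where w < - c' is not negligible;
    the mean value over that set, up to sign, is a functional of norm at most 1 that
    takes a value at least c' at w. *)
Lemma Linfty_norming : (mu setT < +oo)%E -> norming Lf.
Proof.
move=> mufin.
have Afin (A : set T) : measurable A -> (mu A < +oo)%E.
  by move=> mA; apply: le_lt_trans mufin; apply: le_measure => //; exact/mem_set.
have uA (u : Lf) (A : set T) : measurable A ->
    mu.-integrable A (EFin \o u) /\ `|\int[mu]_(x in A) u x| <= `|u| * fine (mu A).
  move=> mA; apply: ae_bounded_integrable => //; first exact: Afin.
    exact: measurable_funTS (Linfty_measurable _).
  by apply: filterS (Linfty_ae_le u).
have avg (A : set T) (sg : R) : measurable A -> mu A != 0%E -> `|sg| = 1 ->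
    unit_functional (fun u : Lf => sg * ((fine (mu A))^-1 * \int[mu]_(x in A) u x)).
  move=> mA A0 sg1.
  have fA : 0 < fine (mu A) by rewrite fine_gt0// Afin// andbT lt0e A0 measure_ge0.
  have aeR (f g : T -> R) : measurable_fun setT f -> measurable_fun setT g ->
      (\forall x \ae mu, f x = g x) -> \int[mu]_(x in A) f x = \int[mu]_(x in A) g x.
    move=> mf mg fg; congr fine; apply: ae_eq_integral => //.
    - by apply/measurable_EFinP; exact: measurable_funTS mf.
    - by apply/measurable_EFinP; exact: measurable_funTS mg.
    - by move: fg; apply: filterS => x -> _.
  split.
  - move=> u v; rewrite -mulrDr -mulrDr -RintegralD//; try exact: (uA _ _ mA).1.
    congr (_ * (_ * _)); apply: aeR (Linfty_addE u v); first exact: Linfty_measurable.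
    by apply: measurable_funD; exact: Linfty_measurable.
  - move=> a u; rewrite (mulrCA a) (mulrCA a).
    have -> : a * \int[mu]_(x in A) (u : Lf) x = \int[mu]_(x in A) (a * (u : Lf) x).
      by rewrite RintegralZl//; exact: (uA _ _ mA).1.
    congr (_ * (_ * _)); apply: aeR (Linfty_scaleE a u); first exact: Linfty_measurable.
    by apply: measurable_funM => //; exact: Linfty_measurable.
  - move=> u; rewrite normrM sg1 mul1r normrM normfV (gtr0_norm fA).
    by rewrite ler_pdivrMl// mulrC; exact: (uA _ _ mA).2.
rewrite /norming -[NormedModule.sort _]/Lf => w c cw; have [c0|c0] := ltP c 0.
  exists (fun=> 0) => //; split => [u v|a u|u]; rewrite ?addr0 ?mulr0 ?normr0//.
pose c' := (c + `|w|) / 2.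
have [cc' c'w] : c < c' /\ c' < `|w| by rewrite /c'; lra.
have mw : measurable_fun setT (w : T -> R) by exact: Linfty_measurable.
pose A := [set x | c' < w x]; pose B := [set x | c' < - w x].
have preim (f : T -> R) : measurable_fun setT f -> measurable [set x | c' < f x].
  move=> mf; rewrite (_ : [set x | _] = setT `&` f @^-1` `]c', +oo[); first exact: mf.
  by rewrite setTI; apply/seteqP; split=> x /=; rewrite in_itv/= andbT.
have mA : measurable A by exact: preim.
have mB : measurable B by apply: preim; exact: measurableT_comp mw.
have fpos (D : set T) : measurable D -> mu D != 0%E -> 0 < fine (mu D).
  by move=> mD D0; rewrite fine_gt0// Afin// andbT lt0e D0 measure_ge0.
have cst_le (D : set T) (f : T -> R) : measurable D -> mu D != 0%E ->
    mu.-integrable D (EFin \o f) -> (forall x, D x -> c' <= f x) ->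
    c < (fine (mu D))^-1 * \int[mu]_(x in D) f x.
  move=> mD D0 If cf; apply: lt_le_trans cc' _; rewrite ler_pdivlMl ?fpos//.
  rewrite mulrC -Rintegral_cst//; apply: le_Rintegral => //.
  by have [] := @ae_bounded_integrable _ _ _ mu D (cst c') `|c'| mD (Afin _ mD)
    (measurable_cst _) (nearW _ (fun x _ => lexx _)).
have [A0|A0] := eqVneq (mu A) 0%E; last first.
  exists (fun u : Lf => 1 * ((fine (mu A))^-1 * \int[mu]_(x in A) u x)).
    by apply: avg => //; rewrite normr1.
  by rewrite mul1r; apply: cst_le => //; [exact: (uA _ _ mA).1|move=> x /ltW].
have [B0|B0] := eqVneq (mu B) 0%E; last first.
  exists (fun u : Lf => -1 * ((fine (mu B))^-1 * \int[mu]_(x in B) u x)).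
    by apply: avg => //; rewrite normrN1.
  rewrite mulN1r -mulrN.
  have -> : - (\int[mu]_(x in B) w x) = \int[mu]_(x in B) (- w x).
    rewrite -mulN1r -RintegralZl//; last exact: (uA _ _ mB).1.
    by apply: eq_Rintegral => x _; rewrite mulN1r.
  apply: cst_le => //; last by move=> x /ltW.
  have := (uA w _ mB).1; move=> /integrableN; exact.
move: c'w; rewrite ltNge => /negP[]; apply: Linfty_norm_le.
  by rewrite /c' divr_ge0// addr_ge0.
exists (A `|` B); split; first exact: measurableU.
  have : (mu (A `|` B) <= mu A + mu B)%E by exact: measureU2.
  by rewrite A0 B0 adde0 => AB; apply/eqP; rewrite eq_le AB measure_ge0.
move=> x /= /negP; rewrite -ltNge => wx.
by move: wx; rewrite ltr_normr => /orP.
Qed.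

End LinftyTheory.

(** * Integral operators with Lipschitz kernels *)

Section MeanValue.
Context (R : realType).

Lemma derive_bound_lipschitz (f df : R -> R) (M : R) :
  (forall x : R, is_derive x 1 f (df x)) -> (forall x, `|df x| <= M) ->
  forall s t, `|f s - f t| <= M * `|s - t|.
Proof.
move=> fdf dM; suff H s t : s <= t -> `|f t - f s| <= M * `|t - s|.
  move=> s t; have [st|/ltW ts] := leP s t; last exact: H.
  by rewrite distrC (distrC s); exact: H.
move=> st; have cf : {within `[s, t], continuous f}.
  apply: continuous_subspaceT => x; apply/differentiable_continuous/derivable1_diffP.
  by have [] := fdf x.
have [c _ ->] := MVT_segment st (fun x _ => fdf x) cf.
by rewrite normrM ler_wpM2r.
Qed.

Definition lipschitz_kernel (M L : R) (k : R * R -> R) :=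
  (forall p, `|k p| <= M) /\
  (forall a b a' b', `|k (a, b) - k (a', b')| <= L * (`|a - a'| + `|b - b'|)).

Lemma lipschitz_kernel_ge0 M L k : lipschitz_kernel M L k -> 0 <= M /\ 0 <= L.
Proof.
move=> [kM kL]; split; first exact: le_trans (normr_ge0 _) (kM (0, 0)).
have := kL 1 0 0 0; rewrite subrr normr0 addr0 subr0 normr1 mulr1.
exact: le_trans.
Qed.

Lemma lipschitz_kernelM M L M' L' k k' :
  lipschitz_kernel M L k -> lipschitz_kernel M' L' k' ->
  lipschitz_kernel (M * M') (L * M' + M * L') (fun p => k p * k' p).
Proof.
move=> kk kk'; have [M0 L0] := lipschitz_kernel_ge0 kk.
have [M'0 L'0] := lipschitz_kernel_ge0 kk'; case: kk kk' => [kM kL] [kM' kL'].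
split=> [p|a b a' b']; first by rewrite normrM ler_pM.
have -> : k (a, b) * k' (a, b) - k (a', b') * k' (a', b') =
    (k (a, b) - k (a', b')) * k' (a, b) + k (a', b') * (k' (a, b) - k' (a', b')) by ring.
apply: le_trans (ler_normD _ _) _; rewrite !normrM mulrDl.
apply: lerD; last by rewrite -mulrA ler_pM.
by rewrite mulrAC ler_pM.
Qed.

(** Only the two partial derivatives are available, so the mean value theorem is
    applied along a horizontal and then a vertical segment. *)
Lemma Cb_kernel (f : R * R -> R) : Cb_R2 1 f -> exists M L, lipschitz_kernel M L f.
Proof.
move=> [cf [M fM] df].
have [d1 [c1 [M1 fM1] _]] := df (1, 0) (mem_head _ _).
have e2 : (0, 1) \in [:: ((1, 0) : R * R); (0, 1)] by rewrite !inE eqxx orbT.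
have [d2 [c2 [M2 fM2] _]] := df _ e2.
have is1 (b a : R) : is_derive a 1 (fun a => f (a, b)) ('D_(1, 0) f (a, b)).
  have E : (fun h : R => h^-1 *: (((fun a => f (a, b)) \o shift a) (h *: 1) - f (a, b))) =
      (fun h : R => h^-1 *: ((f \o shift (a, b)) (h *: ((1, 0) : R * R)) - f (a, b))).
    apply/funext => h; congr (_ *: (f _ - _)).
    by rewrite /shift/= [in RHS]/GRing.scale/= /GRing.add/= /add_pair/= scaler0 add0r.
  by apply: DeriveDef; rewrite /derivable /derive E//; exact: d1.
have is2 (a b : R) : is_derive b 1 (fun b => f (a, b)) ('D_(0, 1) f (a, b)).
  have E : (fun h : R => h^-1 *: (((fun b => f (a, b)) \o shift b) (h *: 1) - f (a, b))) =
      (fun h : R => h^-1 *: ((f \o shift (a, b)) (h *: ((0, 1) : R * R)) - f (a, b))).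
    apply/funext => h; congr (_ *: (f _ - _)).
    by rewrite /shift/= [in RHS]/GRing.scale/= /GRing.add/= /add_pair/= scaler0 add0r.
  by apply: DeriveDef; rewrite /derivable /derive E//; exact: d2.
exists M, (M1 + M2); split => // a b a' b'.
have -> : f (a, b) - f (a', b') = (f (a, b) - f (a', b)) + (f (a', b) - f (a', b')) by ring.
apply: le_trans (ler_normD _ _) _.
have h1 := derive_bound_lipschitz (is1 b) (fun x => fM1 _) a a'.
have h2 := derive_bound_lipschitz (is2 a') (fun x => fM2 _) b b'.
apply: le_trans (lerD h1 h2) _.
have M10 : 0 <= M1 by exact: le_trans (normr_ge0 _) (fM1 (0, 0)).
have M20 : 0 <= M2 by exact: le_trans (normr_ge0 _) (fM2 (0, 0)).
have := mulr_ge0 M20 (normr_ge0 (a - a')); have := mulr_ge0 M10 (normr_ge0 (b - b')).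
lra.
Qed.

Lemma Cb_le (V : normedModType R) (dirs : seq V) k (f : V -> R) :
  Cb dirs k.+1 f -> Cb dirs k f.
Proof.
elim: k f => [|k IH] f [cf bf df]; split => // e edirs.
by have [de Cde] := df e edirs; split => //; exact: IH.
Qed.

End MeanValue.

(* Instance search does not see through the sigma-algebra of Lebesgue measure. *)
#[global] Instance lebesgue_ae_filter (R : realType) :
  Filter (nbhs (almost_everywhere (@lebesgue_measure R))).
Proof. exact: (ae_filter_ringOfSetsType lebesgue_measure). Qed.

Section KernelOperator.
Context (R : realType).
Local Notation lambda := (@lebesgue_measure R).
Local Notation I01 := (`[0, 1]%classic : set R).

(** The value of the operator at a point x with theta x = a. It depends on x through
    [a] only, and in a Lipschitz way, which gives the measurability in x with no
    appeal to product measures. *)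
Definition kernel_op (k : R * R -> R) (theta w : R -> R) (a : R) : R :=
  \int[lambda]_(y in I01) (k (a, theta y) * w y).

Definition ae_bounded (w : R -> R) (W : R) :=
  \forall y \ae lambda, I01 y -> `|w y| <= W.

Lemma lebesgue_I01 : lambda I01 = 1%E.
Proof. by rewrite lebesgue_measure_itv/= lte_fin ltr01 oppr0 adde0. Qed.

Lemma integral_I01_bound (f : R -> R) (C : R) : measurable_fun I01 f ->
  ae_bounded f C ->
  lambda.-integrable I01 (EFin \o f) /\ `|\int[lambda]_(y in I01) f y| <= C.
Proof.
move=> mf fC.
have fin1 : (lambda I01 < +oo)%E by rewrite lebesgue_I01 ltry.
have [i b] := @ae_bounded_integrable _ _ _ lambda I01 f C (measurable_itv _) fin1 mf fC.
split; first exact: i.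
have e1 : C * fine (lambda I01) = C by rewrite lebesgue_I01 mulr1.
by rewrite -[leRHS]e1; exact: b.
Qed.

Variables (M L : R) (k : R * R -> R).
Hypothesis kk : lipschitz_kernel M L k.

Lemma kernel_measurable (theta : R -> R) (a : R) : measurable_fun setT theta ->
  measurable_fun setT (fun y => k (a, theta y)).
Proof.
move=> mt; have ck : continuous (fun b => k (a, b)).
  apply: (@lipschitz_continuous _ R^o R^o L) => [|b c].
    by have [] := lipschitz_kernel_ge0 kk.
  by apply: le_trans (kk.2 _ _ _ _) _; rewrite subrr normr0 add0r.
exact: measurableT_comp (continuous_measurable_fun ck) mt.
Qed.

Lemma kernel_integrable (theta w : R -> R) (W a : R) :
  measurable_fun setT theta -> measurable_fun setT w -> ae_bounded w W ->
  lambda.-integrable I01 (EFin \o (fun y => k (a, theta y) * w y)) /\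
  `|kernel_op k theta w a| <= M * W.
Proof.
move=> mt mw wW; apply: integral_I01_bound.
  by apply: measurable_funTS; apply: measurable_funM => //; exact: kernel_measurable.
move: wW; apply: filterS => y wy yI; rewrite normrM.
have [M0 _] := lipschitz_kernel_ge0 kk.
by rewrite ler_pM// ?wy//; exact: kk.1.
Qed.

Lemma kernel_op_lipschitz (theta theta' w w' : R -> R) (T W D a a' : R) :
  measurable_fun setT theta -> measurable_fun setT theta' ->
  measurable_fun setT w -> measurable_fun setT w' ->
  ae_bounded w W -> ae_bounded w' W ->
  ae_bounded (fun y => theta y - theta' y) T -> ae_bounded (fun y => w y - w' y) D ->
  `|kernel_op k theta w a - kernel_op k theta' w' a'| <=
    L * (`|a - a'| + T) * W + M * D.
Proof.
move=> mt mt' mw mw' wW wW' tT wD.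
have [M0 L0] := lipschitz_kernel_ge0 kk.
have [i1 _] := kernel_integrable a mt mw wW.
have [i2 _] := kernel_integrable a' mt' mw' wW'.
rewrite /kernel_op -RintegralB//.
have mk (th : R -> R) (b : R) : measurable_fun setT th -> measurable_fun setT (fun y => k (b, th y)).
  exact: kernel_measurable.
apply: (proj2 (@integral_I01_bound
  (fun y => k (a, theta y) * w y - k (a', theta' y) * w' y) _ _ _)).
  apply: measurable_funTS; apply: measurable_funB; apply: measurable_funM => //; exact: mk.
have h1 : \forall y \ae lambda, I01 y -> `|w y| <= W /\ `|theta y - theta' y| <= T.
  by move: wW tT; apply: filterS2 => y h1 h2 yI; split; [exact: h1|exact: h2].
move: h1 wD; apply: filterS2 => y h1 h2 yI.
have [wy ty] := h1 yI; have wd := h2 yI.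
have -> : k (a, theta y) * w y - k (a', theta' y) * w' y =
  (k (a, theta y) - k (a', theta' y)) * w y + k (a', theta' y) * (w y - w' y) by ring.
apply: le_trans (ler_normD _ _) _; rewrite !normrM; apply: lerD; apply: ler_pM => //.
  by apply: le_trans (kk.2 _ _ _ _) _; rewrite ler_wpM2l// lerD2l.
exact: kk.1.
Qed.

Lemma kernel_op_measurable (theta w : R -> R) (W : R) :
  measurable_fun setT theta -> measurable_fun setT w -> ae_bounded w W ->
  measurable_fun setT (fun x => kernel_op k theta w (theta x)).
Proof.
move=> mt mw wW; have cJ : continuous (kernel_op k theta w).
  apply: (@lipschitz_continuous _ R^o R^o `|L * W|) => // a c.
  have z (f : R -> R) : ae_bounded (fun y => f y - f y) 0.
    by apply: nearW => y _; rewrite subrr normr0.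
  apply: le_trans
    (kernel_op_lipschitz a c mt mt mw mw wW wW (z theta) (z w)) _.
  by rewrite mulr0 !addr0 mulrAC ler_wpM2r// ler_norm.
exact: measurableT_comp (continuous_measurable_fun cJ) mt.
Qed.

End KernelOperator.

(** * The right-hand side as a Lipschitz vector field *)

Section VectorField.
Context (R : realType).
Local Notation lambda := (@lebesgue_measure R).
Local Notation I01 := (`[0, 1]%classic : set R).
Variables (Gamma : R -> R) (H : R * R -> R) (eps : R).
Variables (M0 L0 M1 L1 M2 L2 : R).

Definition kernelK (p : R * R) := H p * Gamma (p.2 - p.1).
Definition kernelP1 (p : R * R) := Gamma (p.2 - p.1) * D1H H p.
Definition kernelP2 (p : R * R) := Gamma (p.2 - p.1) * D2H H p.

Hypothesis kK : lipschitz_kernel M0 L0 kernelK.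
Hypothesis kP1 : lipschitz_kernel M1 L1 kernelP1.
Hypothesis kP2 : lipschitz_kernel M2 L2 kernelP2.
Hypothesis eps0 : 0 <= eps.

(** Since T[theta] = P[theta; K[theta]] and P[theta; w] is linear in w, the
    right-hand side equals nu + eps P[theta; nu] for nu = omega + K[theta]: the
    double integrals disappear. *)
Definition drift (theta omega : R -> R) (x : R) := omega x + opK Gamma H theta x.

Definition velocity (theta omega : R -> R) (x : R) :=
  drift theta omega x + eps * opP Gamma H theta (drift theta omega) x.

Lemma opKE theta x : opK Gamma H theta x = kernel_op kernelK theta (cst 1) (theta x).
Proof. by apply: eq_Rintegral => y _; rewrite /kernelK/= mulr1. Qed.

Lemma ae_bounded_cst1 : ae_bounded (cst (1 : R)) 1.
Proof. by apply: nearW => y _; rewrite normr1. Qed.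

Section Fixed.
Variables (theta : R -> R).
Hypothesis mt : measurable_fun setT theta.

Lemma opK_measurable : measurable_fun setT (opK Gamma H theta).
Proof.
rewrite (_ : opK _ _ _ = fun x => kernel_op kernelK theta (cst 1) (theta x)).
  exact: (kernel_op_measurable kK mt (measurable_cst _) ae_bounded_cst1).
by apply/funext => x; rewrite opKE.
Qed.

Lemma opK_bound x : `|opK Gamma H theta x| <= M0.
Proof.
rewrite opKE -[leRHS]mulr1.
exact: (kernel_integrable kK _ mt (measurable_cst _) ae_bounded_cst1).2.
Qed.

Lemma opPE omega (W : R) x : measurable_fun setT omega -> ae_bounded omega W ->
  opP Gamma H theta omega x =
  - (omega x * kernel_op kernelP1 theta (cst 1) (theta x) +
     kernel_op kernelP2 theta omega (theta x)).
Proof.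
move=> mw wW; rewrite /opP.
have i1 := (kernel_integrable kP1 (theta x) mt (measurable_cst _) ae_bounded_cst1).1.
have i2 := (kernel_integrable kP2 (theta x) mt mw wW).1.
rewrite /kernel_op -RintegralZl// -RintegralD//; last exact: (integrableZl (mu := lambda) (measurable_itv _) (omega x) i1).
congr (- _); apply: eq_Rintegral => y _.
by rewrite /kernelP1 /kernelP2 /=; ring.
Qed.

(** The integral over z produces K[theta] at theta x, resp. at theta y. *)
Lemma opTE x : opT Gamma H theta x = opP Gamma H theta (opK Gamma H theta) x.
Proof.
have Kb : ae_bounded (opK Gamma H theta) M0 by apply: nearW => y _; exact: opK_bound.
rewrite (opPE x opK_measurable Kb) opprD /opT.
have iK a : lambda.-integrable I01 (EFin \o (fun z => H (a, theta z) * Gamma (theta z - a))).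
  have := (kernel_integrable kK a mt (measurable_cst _) ae_bounded_cst1).1.
  by apply: eq_integrable => // z _; rewrite /kernelK/= mulr1.
congr (- _ - _).
  rewrite /kernel_op -RintegralZl//; last first.
    exact: (kernel_integrable kP1 (theta x) mt (measurable_cst _) ae_bounded_cst1).1.
  apply: eq_Rintegral => y _.
  transitivity (kernelP1 (theta x, theta y) * opK Gamma H theta x); last first.
    by rewrite /= mulr1 mulrC.
  rewrite /opK -RintegralZl//.
  by apply: eq_Rintegral => z _; rewrite /kernelP1/=; ring.
apply: eq_Rintegral => y _; rewrite /opK -RintegralZl//.
by apply: eq_Rintegral => z _; rewrite /kernelP2/=; ring.
Qed.

Variables (omega : R -> R) (W : R).
Hypotheses (mw : measurable_fun setT omega) (wW : ae_bounded omega W).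

Lemma drift_measurable : measurable_fun setT (drift theta omega).
Proof. by apply: measurable_funD => //; exact: opK_measurable. Qed.

Lemma drift_bounded : ae_bounded (drift theta omega) (W + M0).
Proof.
move: wW; apply: filterS => x wx xI; apply: le_trans (ler_normD _ _) _.
by apply: lerD; [exact: wx|exact: opK_bound].
Qed.

Lemma velocityE x : velocity theta omega x =
  omega x + opK Gamma H theta x + eps * opP Gamma H theta omega x
  + eps * opT Gamma H theta x.
Proof.
have Kb : ae_bounded (opK Gamma H theta) M0 by apply: nearW => y _; exact: opK_bound.
rewrite /velocity opTE (opPE x drift_measurable drift_bounded) (opPE x mw wW).
rewrite (opPE x opK_measurable Kb).
have -> : kernel_op kernelP2 theta (drift theta omega) (theta x) =
    kernel_op kernelP2 theta omega (theta x) +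
    kernel_op kernelP2 theta (opK Gamma H theta) (theta x).
  rewrite /kernel_op -RintegralD//.
  - by apply: eq_Rintegral => y _; rewrite -mulrDr.
  - exact: (kernel_integrable kP2 (theta x) mt mw wW).1.
  - exact: (kernel_integrable kP2 (theta x) mt opK_measurable Kb).1.
by rewrite /drift; ring.
Qed.

Lemma velocity_measurable : measurable_fun setT (velocity theta omega).
Proof.
rewrite (_ : velocity _ _ = fun x => drift theta omega x + eps *
  - (drift theta omega x * kernel_op kernelP1 theta (cst 1) (theta x) +
     kernel_op kernelP2 theta (drift theta omega) (theta x))); last first.
  by apply/funext => x; rewrite /velocity (opPE x drift_measurable drift_bounded).
have md := drift_measurable.
apply: measurable_funD => //; apply: measurable_funM => //; apply: measurableT_comp => //.
apply: measurable_funD; last exact: (kernel_op_measurable kP2 mt md drift_bounded).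
apply: measurable_funM => //.
exact: (kernel_op_measurable kP1 mt (measurable_cst _) ae_bounded_cst1).
Qed.

Lemma velocity_bounded : ae_bounded (velocity theta omega) ((W + M0) * (1 + eps * (M1 + M2))).
Proof.
move: drift_bounded; apply: filterS => x dx xI.
rewrite /velocity (opPE x drift_measurable drift_bounded).
have b1 := (kernel_integrable kP1 (theta x) mt (measurable_cst _) ae_bounded_cst1).2.
have b2 := (kernel_integrable kP2 (theta x) mt drift_measurable drift_bounded).2.
have {}dx := dx xI; rewrite mulr1 in b1.
apply: le_trans (ler_normD _ _) _; rewrite normrM normrN (ger0_norm eps0).
have -> : (W + M0) * (1 + eps * (M1 + M2)) =
  (W + M0) + eps * ((W + M0) * M1 + M2 * (W + M0)) by ring.
apply: lerD => //; apply: ler_wpM2l => //; apply: le_trans (ler_normD _ _) _.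
by apply: lerD => //; rewrite normrM ler_pM.
Qed.

End Fixed.

Definition velocity_lip (W : R) :=
  2 * L0 * (1 + eps * (M1 + M2)) + 2 * eps * (L1 + L2) * (W + M0).

(** Every factor is bounded and Lipschitz in theta; the constant depends on omega
    only through its bound [W], because omega enters linearly. *)
Lemma velocity_lipschitz (theta theta' omega omega' : R -> R) (W D T : R) :
  measurable_fun setT theta -> measurable_fun setT theta' ->
  measurable_fun setT omega -> measurable_fun setT omega' ->
  ae_bounded omega W -> ae_bounded omega' W ->
  ae_bounded (fun y => theta y - theta' y) T ->
  ae_bounded (fun y => omega y - omega' y) D ->
  ae_bounded (fun y => velocity theta omega y - velocity theta' omega' y)
    ((1 + eps * (M1 + M2)) * D + velocity_lip W * T).
Proof.
move=> mt mt' mw mw' wW wW' tT wD.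
have [M0_ge0 L0_ge0] := lipschitz_kernel_ge0 kK.
have [M1_ge0 L1_ge0] := lipschitz_kernel_ge0 kP1.
have [M2_ge0 L2_ge0] := lipschitz_kernel_ge0 kP2.
have md := drift_measurable mt mw; have md' := drift_measurable mt' mw'.
have dW := drift_bounded mt wW; have dW' := drift_bounded mt' wW'.
have z1 : ae_bounded (fun y => (cst 1 : R -> R) y - (cst 1 : R -> R) y) 0.
  by apply: nearW => y _; rewrite subrr normr0.
pose dd := D + L0 * (2 * T).
have dD : ae_bounded (fun y => drift theta omega y - drift theta' omega' y) dd.
  have tT' := tT; move: tT' wD; apply: filterS2 => x tx wx xI.
  have {}tx := tx xI; have {}wx := wx xI.
  rewrite /drift !opKE.
  have := kernel_op_lipschitz kK (theta x) (theta' x) mt mt' (measurable_cst _)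
    (measurable_cst _) ae_bounded_cst1 ae_bounded_cst1 tT z1.
  rewrite mulr1 mulr0 addr0; set A := kernel_op _ _ _ _; set B := kernel_op _ _ _ _ => AB.
  have -> : omega x + A - (omega' x + B) = (omega x - omega' x) + (A - B) by ring.
  apply: le_trans (ler_normD _ _) _; apply: lerD => //; apply: le_trans AB _.
  by rewrite ler_wpM2l//; lra.
have good : \forall x \ae lambda, I01 x -> [/\ `|drift theta omega x - drift theta' omega' x| <= dd,
    `|drift theta' omega' x| <= W + M0 & `|theta x - theta' x| <= T].
  move: tT dD dW'; apply: filterS3 => x t1 t2 t3 xI.
  by split; [exact: t2|exact: t3|exact: t1].
move: good; apply: filterS => x gx xI; have [dx dx' tx] := gx xI.
rewrite /velocity (opPE mt x md dW) (opPE mt' x md' dW').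
have := kernel_op_lipschitz kP1 (theta x) (theta' x) mt mt' (measurable_cst _)
    (measurable_cst _) ae_bounded_cst1 ae_bounded_cst1 tT z1.
have := kernel_op_lipschitz kP2 (theta x) (theta' x) mt mt' md md' dW dW' tT dD.
have := (kernel_integrable kP1 (theta x) mt (measurable_cst _) ae_bounded_cst1).2.
rewrite !mulr1 mulr0 addr0.
set J := kernel_op kernelP1 _ _ _; set J' := kernel_op kernelP1 _ _ _.
set Q := kernel_op kernelP2 _ _ _; set Q' := kernel_op kernelP2 _ _ _.
move: (drift theta omega x) (drift theta' omega' x) dx dx' => d d' dx dx' Jb Qb JJ.
have W0 : 0 <= W + M0 by exact: le_trans dx'.
have tT2 : `|theta x - theta' x| + T <= 2 * T by lra.
have {}JJ : `|J - J'| <= L1 * (2 * T) by apply: le_trans JJ _; rewrite ler_wpM2l.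
have {}Qb : `|Q - Q'| <= L2 * (2 * T) * (W + M0) + M2 * dd.
  by apply: le_trans Qb _; rewrite lerD2r ler_wpM2r// ler_wpM2l.
have -> : d + eps * - (d * J + Q) - (d' + eps * - (d' * J' + Q')) =
  (d - d') - eps * ((d - d') * J + d' * (J - J') + (Q - Q')) by ring.
apply: le_trans (ler_normB _ _) _; rewrite normrM (ger0_norm eps0).
have inner : `|(d - d') * J + d' * (J - J') + (Q - Q')| <=
    dd * M1 + (W + M0) * (L1 * (2 * T)) + (L2 * (2 * T) * (W + M0) + M2 * dd).
  apply: le_trans (ler_normD _ _) _; apply: lerD => //.
  apply: le_trans (ler_normD _ _) _.
  by apply: lerD; rewrite normrM ler_pM.
apply: le_trans (lerD dx (ler_wpM2l eps0 inner)) _.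
rewrite le_eqVlt; apply/orP; left; apply/eqP.
by rewrite /dd /velocity_lip; ring.
Qed.

End VectorField.

(** * Calculus of curves, weak derivatives and a Gronwall estimate *)

Lemma subr_interchange (Z : zmodType) (a b c d : Z) : a - b - (c - d) = a - c - (b - d).
Proof. by rewrite !opprB addrACA [RHS]addrACA (addrC (- b)). Qed.

Section Calculus.
Context (R : realType) (V : normedModType R).
Variable tau : R.
Implicit Types (p : R -> R) (f u : R -> V).

Lemma lipschitz_scale P K p f : lipschitz_on (V := R^o) tau P p -> lipschitz_on tau K f ->
  exists B, lipschitz_on tau B (fun t => p t *: f t).
Proof.
move=> lp lf; pose Pb := `|p 0| + `|P| * tau; pose Fb := `|f 0| + `|K| * tau.
exists (P * Fb + Pb * K) => s t s0 st tt.
have t0 := le_trans s0 st; have s_tau := le_trans st tt.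
have t_s : 0 <= t - s by rewrite subr_ge0.
have ps : `|p s| <= Pb by exact: (lipschitz_on_bound lp).
have ft : `|f t| <= Fb by exact: (lipschitz_on_bound lf).
have -> : p t *: f t - p s *: f s = (p t - p s) *: f t + p s *: (f t - f s).
  by rewrite scalerBl scalerBr addrA subrK.
apply: le_trans (ler_normD _ _) _; rewrite !normrZ.
have -> : (P * Fb + Pb * K) * (t - s) = P * (t - s) * Fb + Pb * (K * (t - s)) by ring.
by apply: lerD; apply: ler_pM => //; [exact: lp|exact: lf].
Qed.

Lemma antiderivative_sub C C' f g u v : has_antiderivative tau C f u ->
  has_antiderivative tau C' g v ->
  has_antiderivative tau (C + C') (fun t => f t - g t) (fun t => u t - v t).
Proof.
move=> fu gv s t s0 st tt.
have -> : u t - v t - (u s - v s) - (t - s) *: (f s - g s) =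
    (u t - u s - (t - s) *: f s) - (v t - v s - (t - s) *: g s).
  by rewrite scalerBr (subr_interchange (u t)) (subr_interchange (u t - u s)).
rewrite mulrDl; apply: le_trans (ler_normB _ _) _.
by apply: lerD; [exact: fu|exact: gv].
Qed.

Lemma antiderivative_scale P K C C' p dp f u :
  lipschitz_on (V := R^o) tau P dp -> lipschitz_on tau K f ->
  has_antiderivative (V := R^o) tau C dp p -> has_antiderivative tau C' f u ->
  exists B, has_antiderivative tau B (fun t => dp t *: u t + p t *: f t) (fun t => p t *: u t).
Proof.
move=> ldp lf dpp fu.
have [Lp lp] := antiderivative_lipschitz ldp dpp.
have [Lu lu] := antiderivative_lipschitz lf fu.
pose Pb := `|p 0| + `|Lp| * tau; pose Ub := `|u 0| + `|Lu| * tau.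
pose Db := `|dp 0| + `|P| * tau.
exists (C * Ub + Pb * C' + Db * Lu) => s t s0 st tt.
have t0 := le_trans s0 st; have s_tau := le_trans st tt.
have t_s : 0 <= t - s by rewrite subr_ge0.
have ps : `|p s| <= Pb by exact: (lipschitz_on_bound lp).
have ds : `|dp s| <= Db by exact: (lipschitz_on_bound ldp).
have ut : `|u t| <= Ub by exact: (lipschitz_on_bound lu).
have -> : p t *: u t - p s *: u s - (t - s) *: (dp s *: u s + p s *: f s) =
    (p t - p s - (t - s) * dp s) *: u t + p s *: (u t - u s - (t - s) *: f s)
    + ((t - s) * dp s) *: (u t - u s).
  move: (t - s) => h; rewrite !scalerBl !scalerBr scalerDr !scalerA (mulrC (p s) h) opprD !addrA.
  move: (p t *: u t) (p s *: u t) ((h * dp s) *: u t) (p s *: u s)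
    ((h * dp s) *: u s) ((h * p s) *: f s) => A B X Bs Xs Y.
  rewrite (addrAC _ (- X) B) subrK (addrAC _ (- X) (- Bs)) (addrAC _ (- X) (- Y)) subrK.
  by rewrite (addrAC _ (- Xs)).
apply: le_trans (ler_normD _ _) _.
have -> : (C * Ub + Pb * C' + Db * Lu) * (t - s) ^+ 2 =
  C * (t - s) ^+ 2 * Ub + Pb * (C' * (t - s) ^+ 2) + (t - s) * Db * (Lu * (t - s)) by ring.
apply: lerD.
  apply: le_trans (ler_normD _ _) _; rewrite !normrZ.
  by apply: lerD; apply: ler_pM => //; [exact: dpp|exact: fu].
rewrite normrZ normrM (ger0_norm t_s); apply: ler_pM => //; first by rewrite mulr_ge0.
  by rewrite ler_wpM2l.
exact: lu.
Qed.

(** Integration of [f] is the special case of the differential equation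
    u' = F t u where F does not depend on u; freezing [f] outside [0, tau] makes it
    bounded and Lipschitz on the whole line, as Euler's scheme requires. *)
Lemma lipschitz_antiderivative K f : 0 <= tau -> fast_cauchy_complete V -> lipschitz_on tau K f ->
  exists C u, has_antiderivative tau C f u.
Proof.
move=> tau0 cV lf; pose clamp t := Num.max 0 (Num.min t tau).
have clamp_in t : 0 <= clamp t /\ clamp t <= tau.
  by rewrite /clamp le_max lexx /= ge_max tau0 ge_min lexx orbT.
have clampE t : 0 <= t -> t <= tau -> clamp t = t.
  by move=> t0 tt; rewrite /clamp min_l// max_r.
have clamp_lip s t : `|clamp t - clamp s| <= `|t - s|.
  suff H a b : a <= b -> `|clamp b - clamp a| <= `|b - a|.
    by have [st|/ltW ts] := leP s t; [exact: H|rewrite distrC (distrC t); exact: H].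
  move=> ab; rewrite [leRHS]ger0_norm ?subr_ge0// ler_norml /clamp !maxEle !minEle.
  case: (leP a tau) => ?; case: (leP b tau) => ?; case: (leP 0 a) => ?;
    case: (leP 0 b) => ?; case: (leP 0 tau) => ?; lra.
pose F t (_ : V) := f (clamp t).
have Fb t v : `|F t v| <= `|f 0| + `|K| * tau.
  by have [c0 ct] := clamp_in t; exact: (lipschitz_on_bound lf).
have fK s t : `|f (clamp t) - f (clamp s)| <= `|K| * `|t - s|.
  have H a b : 0 <= a -> a <= b -> b <= tau -> `|f b - f a| <= `|K| * `|b - a|.
    move=> a0 ab bt; apply: le_trans (lf _ _ a0 ab bt) _.
    by rewrite (@ger0_norm _ (b - a)) ?subr_ge0// ler_wpM2r ?subr_ge0// ler_norm.
  have [cs0 cst] := clamp_in s; have [ct0 ctt] := clamp_in t.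
  apply: (@le_trans _ _ (`|K| * `|clamp t - clamp s|)); last by rewrite ler_wpM2l.
  by have [cc|/ltW cc] := leP (clamp s) (clamp t); [exact: H|rewrite distrC (distrC (clamp t)); exact: H].
have Fl s t v w : `|F t v - F s w| <= `|K| * (`|t - s| + `|v - w|).
  by apply: le_trans (fK _ _) _; rewrite ler_wpM2l// lerDl.
exists (`|K| * (1 + (`|f 0| + `|K| * tau))), (solution F (0 : V)) => s t s0 st tt.
have := solution_antiderivative Fb Fl (normr_ge0 _) 0 cV s0 st.
by rewrite /F clampE// (le_trans st).
Qed.

End Calculus.

Section TestFunctions.
Context (R : realType).
Implicit Types (g phi : R -> R) (tau : R).

Lemma derivable_lipschitz tau g : 0 <= tau -> (forall x, derivable g x 1) ->
  (forall x, derivable g^`()%classic x 1) ->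
  exists K, 0 <= K /\ lipschitz_on (V := R^o) tau K g.
Proof.
move=> tau0 dg ddg.
have cg : continuous g by move=> x; apply/differentiable_continuous/derivable1_diffP.
have cdg : continuous g^`()%classic.
  by move=> x; apply/differentiable_continuous/derivable1_diffP.
have [|c _ cmax] := @EVT_max R (fun x => `|g^`()%classic x|) 0 tau tau0.
  by apply: continuous_subspaceT => x; apply: continuous_comp; [exact: cdg|exact: norm_continuous].
exists `|g^`()%classic c|; split => // s t s0 st tt.
have isd (x : R) : x \in `]s, t[ -> is_derive x 1 g (g^`()%classic x).
  by move=> _; rewrite derive1E; exact/derivableP.
have [x] := MVT_segment st isd (continuous_subspaceT cg).
rewrite in_itv/= => /andP[sx xt] ->; rewrite normrM (@ger0_norm _ (t - s)) ?subr_ge0//.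
apply: ler_wpM2r; first by rewrite subr_ge0.
by apply: cmax; rewrite in_itv/= (le_trans s0)// (le_trans xt).
Qed.

Lemma derivable_antiderivative tau K g : (forall x, derivable g x 1) ->
  0 <= K -> lipschitz_on (V := R^o) tau K g^`()%classic ->
  has_antiderivative (V := R^o) tau K g^`()%classic g.
Proof.
move=> dg K0 lg s t s0 st tt.
have cg : continuous g by move=> x; apply/differentiable_continuous/derivable1_diffP.
have isd (x : R) : x \in `]s, t[ -> is_derive x 1 g (g^`()%classic x).
  by move=> _; rewrite derive1E; exact/derivableP.
have [x] := MVT_segment st isd (continuous_subspaceT cg).
rewrite in_itv/= => /andP[sx xt] ->.
have t_s : 0 <= t - s by rewrite subr_ge0.
have -> : g^`()%classic x * (t - s) - (t - s) *: g^`()%classic s =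
  (t - s) * (g^`()%classic x - g^`()%classic s) by rewrite /GRing.scale/=; ring.
rewrite normrM (ger0_norm t_s) expr2 mulrCA; apply: ler_wpM2l => //.
apply: le_trans (lg _ _ s0 sx (le_trans xt tt)) _.
by apply: ler_wpM2l => //; rewrite lerD2r.
Qed.

Lemma test_function_bounds tau phi : test_function tau phi -> phi 0 = 0 /\ phi tau = 0.
Proof.
move=> [_ _ supp]; have phi_in t : phi t != 0 -> t \in `]0, tau[.
  by move=> pt; apply: (supp t); exact: subset_closure.
split; apply/eqP; apply: contraT => /phi_in.
  by rewrite in_itv/= ltxx.
by rewrite in_itv/= ltxx andbF.
Qed.

Lemma test_function_derivable tau phi : test_function tau phi ->
  [/\ forall x, derivable phi x 1, forall x, derivable phi^`()%classic x 1 &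
      forall x, derivable phi^`()^`()%classic x 1].
Proof.
by move=> [d _ _]; split => x; [exact: (d 0%N)|exact: (d 1%N)|exact: (d 2%N)].
Qed.

End TestFunctions.

Section WeakDerivative.
Context (R : realType) (V : normedModType R).
Local Notation lambda := (@lebesgue_measure R).
Hypothesis nV : norming V.
Hypothesis cV : fast_cauchy_complete V.

(** Let v be an antiderivative of phi' u. The product rule makes phi u - v one of
    phi f, and phi vanishes at both ends, so the two Bochner integrals are the
    opposite increments of v. *)
Lemma antiderivative_W1infty (tau K C : R) (f u : R -> V) : 0 < tau ->
  lipschitz_on tau K f -> has_antiderivative tau C f u -> W1infty tau u f.
Proof.
move=> tau0 lf fu; have [B lu] := antiderivative_lipschitz lf fu.
have bochner g L : lipschitz_on tau L g -> bochner_Linfty lambda `[0, tau] g.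
  move=> lg; split; first exact: (lipschitz_strongly_measurable lg).
  exists (`|g 0| + `|L| * tau); apply: nearW => t /=; rewrite in_itv/= => /andP[t0 tt].
  exact: (lipschitz_on_bound lg).
split; [exact: bochner lu|exact: bochner lf|].
move=> phi tphi; have [d0 d1 d2] := test_function_derivable tphi.
have [phi0 phitau] := test_function_bounds tphi.
have [P [P0 lphi]] := derivable_lipschitz (ltW tau0) d0 d1.
have [Q [Q0 ldphi]] := derivable_lipschitz (ltW tau0) d1 d2.
have aphi := derivable_antiderivative d0 Q0 ldphi.
have [L1 l1] := lipschitz_scale ldphi lu.
have [L2 l2] := lipschitz_scale lphi lf.
have [C1 [v a1]] := lipschitz_antiderivative (ltW tau0) cV l1.
have [C2 a2] := antiderivative_scale ldphi lf aphi fu.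
have a3 := antiderivative_sub a2 a1.
exists (v tau - v 0); split.
  exact: (lipschitz_bochner_integral tau0 l1 nV a1).
have a4 : has_antiderivative tau (C2 + C1) (fun t => phi t *: f t) (fun t => phi t *: u t - v t).
  move=> s t s0 st tt; have := a3 s t s0 st tt.
  by rewrite (addrC (phi^`()%classic s *: u s)) addrK.
have := lipschitz_bochner_integral tau0 l2 nV a4.
by rewrite phi0 phitau !scale0r !sub0r opprK addrC opprB.
Qed.

End WeakDerivative.

Section Gronwall.
Context (R : realType) (V : normedModType R).

(** A Gronwall estimate that involves no integral: over a time step del with
    Lam del <= 1/2 the maximum of |w| absorbs half of itself, so |w| + 2 del p at
    most doubles. The number of steps depends only on tau and Lam. *)
Lemma discrete_gronwall (tau Lam p : R) (w : R -> V) : 0 <= tau -> 0 <= Lam -> 0 <= p ->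
  {within `[0, tau], continuous w} ->
  (forall a b M, 0 <= a -> a <= b -> b <= tau ->
     (forall x, a < x < b -> p + Lam * `|w x| <= M) -> `|w b - w a| <= M * (b - a)) ->
  forall t, 0 <= t -> t <= tau ->
    `|w t| <= 2 ^+ (Num.truncn (2 * tau * Lam)).+1 * (`|w 0| + 2 * tau * p).
Proof.
move=> tau0 Lam0 p0 cw growth; pose N := (Num.truncn (2 * tau * Lam)).+1.
have N0 : 0 < N%:R :> R by rewrite ltr0n.
pose del := tau / N%:R.
have del0 : 0 <= del by rewrite divr_ge0// ltW.
have delLam : del * Lam <= 2^-1.
  have tN : 2 * tau * Lam < N%:R by exact: truncnS_gt.
  rewrite /del mulrAC ler_pdivrMr//; lra.
have del_tau : del <= tau by rewrite ler_pdivrMr// ler_peMr// ler1n.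
pose q := 2 * del * p.
have q0 : 0 <= q by rewrite !mulr_ge0.
have local a t : 0 <= a -> a <= t -> t <= a + del -> t <= tau -> `|w t| + q <= 2 * (`|w a| + q).
  move=> a0 at_ tdel tt.
  have cwat : {within `[a, t], continuous (fun x => `|w x|)}.
    move=> x; apply: cvg_norm.
    apply: (continuous_subspaceW _ cw) => y; rewrite /= !in_itv/= => /andP[ay yt].
    by rewrite (le_trans a0)// (le_trans yt).
  have [c] := EVT_max at_ cwat; rewrite in_itv/= => /andP[ac ct] cmax.
  have wc : `|w c - w a| <= (p + Lam * `|w c|) * (c - a).
    apply: growth => //; first exact: le_trans tt.
    move=> x /andP[ax xc]; rewrite lerD2l ler_wpM2l// cmax// in_itv/= ltW//=.
    exact: le_trans (ltW xc) ct.
  have ca : c - a <= del by lra.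
  have ca0 : 0 <= c - a by lra.
  have h1 : `|w c| <= `|w a| + (p + Lam * `|w c|) * del.
    have := ler_normD (w c - w a) (w a); rewrite subrK addrC => /le_trans; apply.
    rewrite lerD2l; apply: le_trans wc _; apply: ler_wpM2l => //.
    by rewrite addr_ge0// mulr_ge0.
  have h2 : Lam * `|w c| * del <= 2^-1 * `|w c|.
    by rewrite mulrAC (mulrC Lam) ler_wpM2r.
  have wt : `|w t| <= `|w c| by apply: cmax; rewrite in_itv/= at_ lexx.
  rewrite /q; nra.
have steps k t : (k <= N)%N -> 0 <= t -> t <= k%:R * del -> `|w t| + q <= 2 ^+ k * (`|w 0| + q).
  elim: k t => [|k IH] t kN t0 tk.
    rewrite mul0r in tk; have -> : t = 0 by apply/eqP; rewrite eq_le t0 tk.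
    by rewrite expr0 mul1r.
  have kdel : k%:R * del <= tau.
    by rewrite /del mulrCA ler_piMr// ler_pdivrMr// mul1r ler_nat ltnW.
  have [tk'|kt] := leP t (k%:R * del).
    apply: le_trans (IH _ (ltnW kN) t0 tk') _; rewrite ler_wpM2r ?addr_ge0//.
    by rewrite exprS ler_peMl ?exprn_ge0// ler1n.
  have kd0 : 0 <= k%:R * del by rewrite mulr_ge0.
  have tt : t <= tau.
    apply: le_trans tk _.
    by rewrite /del mulrCA ler_piMr// ler_pdivrMr// mul1r ler_nat.
  have tk2 : t <= k%:R * del + del by move: tk; rewrite -natr1 mulrDl mul1r.
  apply: le_trans (local _ _ kd0 (ltW kt) tk2 tt) _.
  rewrite exprS -mulrA ler_wpM2l//; exact: IH (ltnW kN) kd0 (lexx _).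
move=> t t0 tt; have tN : t <= N%:R * del by rewrite /del mulrC divfK// gt_eqF.
have := steps N t (leqnn _) t0 tN.
have qle : q <= 2 * tau * p by rewrite /q ler_wpM2r// ler_wpM2l.
move=> h; apply: (@le_trans _ _ (2 ^+ N * (`|w 0| + q))).
  by apply: le_trans h; rewrite lerDl.
by rewrite ler_wpM2l ?exprn_ge0// lerD2l.
Qed.

End Gronwall.

(** * Strong solutions *)

Section Linfty01Theory.
Context (R : realType).
Local Notation lambda := (@lebesgue_measure R).
Local Notation I01 := (`[0, 1]%classic : set R).
Local Notation mu01 := (mrestr lambda (measurable_itv `[0, 1])).
Implicit Types (u v : Linfty01 R).

Lemma ae_mrestr (P : R -> Prop) :
  (\forall x \ae mu01, P x) <-> (\forall x \ae lambda, I01 x -> P x).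
Proof.
split=> -[N [mN N0 PN]].
  exists (N `&` I01); split => //; first exact: measurableI.
  by move=> x /= /not_implyP[xI Px]; split => //; exact: PN.
exists (N `|` ~` I01); split.
- by apply: measurableU => //; exact: measurableC.
- rewrite /mrestr setIUl setICl setU0; apply: (subset_measure0 _ mN) => //.
  exact: measurableI.
move=> x /= Px; have [xI|xI] := pselect (I01 x); last by right.
by left; apply: PN => /= /(_ xI).
Qed.

Lemma mu01_finite : (mu01 setT < +oo)%E.
Proof. by rewrite /mrestr setTI lebesgue_I01 ltry. Qed.

Lemma Linfty01_norming : norming (Linfty01 R).
Proof. exact: (Linfty_norming mu01_finite). Qed.

Lemma Linfty01_complete : fast_cauchy_complete (Linfty01 R).
Proof. exact: Linfty_complete. Qed.

Lemma Linfty01_measurable u : measurable_fun setT (u : R -> R).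
Proof. exact: (@Linfty_measurable _ _ _ mu01 u). Qed.

Lemma Linfty01_bounded u : ae_bounded u `|u|.
Proof. exact/ae_mrestr/(@Linfty_ae_le _ _ _ mu01 u). Qed.

Lemma Linfty01_subE u v : \forall x \ae lambda, I01 x -> (u - v : Linfty01 R) x = u x - v x.
Proof. exact/ae_mrestr/(@Linfty_subE _ _ _ mu01 u v). Qed.

Lemma Linfty01_sub_bounded u v : ae_bounded (fun x => u x - v x) `|u - v|.
Proof.
have h1 := Linfty01_subE u v; have := Linfty01_bounded (u - v); move: h1.
by apply: filterS2 => x e b xI; rewrite -e//; exact: b.
Qed.

Lemma Linfty01_norm_le u (C : R) : 0 <= C -> ae_bounded u C -> `|u| <= C.
Proof. by move=> C0 /ae_mrestr uC; exact: (@Linfty_norm_le _ _ _ mu01 u C). Qed.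

Lemma Linfty01_eq u v : (\forall x \ae lambda, I01 x -> u x = v x) -> u = v.
Proof.
move=> uv; apply/(@Linfty_eqP _ _ _ mu01 u v).
have : \forall x \ae lambda, I01 x -> True -> u x = v x.
  by move: uv; apply: filterS => x e xI _; exact: e.
by move/ae_mrestr.
Qed.

Definition Linfty01_of (f : R -> R) : Linfty01 R := Linfty_of mu01 f.

Lemma Linfty01_ofE (f : R -> R) (C : R) : measurable_fun setT f -> ae_bounded f C ->
  \forall x \ae lambda, I01 x -> Linfty01_of f x = f x.
Proof. by move=> mf /ae_mrestr fC; apply/ae_mrestr; exact: (@Linfty_ofE _ _ _ mu01 f C mf fC). Qed.

End Linfty01Theory.

Section StrongSolutions.
Context (R : realType).
Local Notation lambda := (@lebesgue_measure R).
Local Notation I01 := (`[0, 1]%classic : set R).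
Local Notation Lp := (Linfty01 R).
Variables (Gamma : R -> R) (H : R * R -> R) (eps : R).
Variables (M0 L0 M1 L1 M2 L2 : R).
Hypothesis kK : lipschitz_kernel M0 L0 (kernelK Gamma H).
Hypothesis kP1 : lipschitz_kernel M1 L1 (kernelP1 Gamma H).
Hypothesis kP2 : lipschitz_kernel M2 L2 (kernelP2 Gamma H).
Hypothesis eps0 : 0 <= eps.

Local Notation velocity := (velocity Gamma H eps).
Local Notation Lam := (velocity_lip eps M0 L0 M1 L1 M2 L2).
Let B := 1 + eps * (M1 + M2).

Let M0_ge0 : 0 <= M0. Proof. by have [] := lipschitz_kernel_ge0 kK. Qed.
Let L0_ge0 : 0 <= L0. Proof. by have [] := lipschitz_kernel_ge0 kK. Qed.
Let B_ge0 : 0 <= B.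
Proof.
have [M1_ge0 _] := lipschitz_kernel_ge0 kP1; have [M2_ge0 _] := lipschitz_kernel_ge0 kP2.
by rewrite addr_ge0// mulr_ge0// addr_ge0.
Qed.

Lemma velocity_lip_ge0 W : 0 <= W -> 0 <= Lam W.
Proof.
have [_ L1_ge0] := lipschitz_kernel_ge0 kP1; have [_ L2_ge0] := lipschitz_kernel_ge0 kP2.
move=> W0; have [M1_ge0 _] := lipschitz_kernel_ge0 kP1.
have [M2_ge0 _] := lipschitz_kernel_ge0 kP2.
by rewrite /velocity_lip addr_ge0// !mulr_ge0// ?addr_ge0// mulr_ge0// addr_ge0.
Qed.

(** The right-hand side, as a map of the Banach space into itself. *)
Definition Lvelocity (omega theta : Lp) : Lp := Linfty01_of (velocity theta omega).

Lemma LvelocityE omega theta :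
  \forall x \ae lambda, I01 x -> Lvelocity omega theta x = velocity theta omega x.
Proof.
have mt := Linfty01_measurable theta; have mw := Linfty01_measurable omega.
have wW := Linfty01_bounded omega.
exact: (Linfty01_ofE (velocity_measurable eps kK kP1 kP2 mt mw wW)
  (velocity_bounded kK kP1 kP2 eps0 mt mw wW)).
Qed.

Lemma Lvelocity_bound omega theta : `|Lvelocity omega theta| <= (`|omega| + M0) * B.
Proof.
have mt := Linfty01_measurable theta; have mw := Linfty01_measurable omega.
apply: Linfty01_norm_le; first by rewrite mulr_ge0// addr_ge0.
have := velocity_bounded kK kP1 kP2 eps0 mt mw (Linfty01_bounded omega).
have := LvelocityE omega theta; apply: filterS2 => x e b xI; rewrite e//; exact: b.
Qed.

Lemma Lvelocity_lipschitz (omega omega' theta theta' : Lp) (W : R) : `|omega| <= W -> `|omega'| <= W ->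
  `|Lvelocity omega theta - Lvelocity omega' theta'| <=
    B * `|omega - omega'| + Lam W * `|theta - theta'|.
Proof.
move=> wW wW'; have W0 : 0 <= W := le_trans (normr_ge0 _) wW.
have mt := Linfty01_measurable theta; have mw := Linfty01_measurable omega.
have mt' := Linfty01_measurable theta'; have mw' := Linfty01_measurable omega'.
have bW (o : Lp) : `|o| <= W -> ae_bounded o W.
  move=> oW; have := Linfty01_bounded o; apply: filterS => x ox xI.
  exact: le_trans (ox xI) oW.
apply: Linfty01_norm_le.
  by rewrite addr_ge0// mulr_ge0// velocity_lip_ge0.
have FL := velocity_lipschitz kK kP1 kP2 eps0 mt mt' mw mw' (bW _ wW) (bW _ wW')
  (Linfty01_sub_bounded theta theta') (Linfty01_sub_bounded omega omega').
have e12 : \forall x \ae lambda, I01 x ->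
    Lvelocity omega theta x = velocity theta omega x /\ Lvelocity omega' theta' x = velocity theta' omega' x.
  have e1 := LvelocityE omega theta; have := LvelocityE omega' theta'; move: e1.
  by apply: filterS2 => x e1 e2 xI; split; [exact: e1|exact: e2].
have := Linfty01_subE (Lvelocity omega theta) (Lvelocity omega' theta'); move: FL e12.
apply: filterS3 => x b e12 es xI; have [e1 e2] := e12 xI.
have e := etrans (es xI) (f_equal2 (fun a b : R => a - b) e1 e2).
by apply: le_trans (b xI); rewrite -e.
Qed.

Lemma Lvelocity_lipschitz_theta (omega v w : Lp) :
  `|Lvelocity omega v - Lvelocity omega w| <= Lam `|omega| * `|v - w|.
Proof.
apply: le_trans (Lvelocity_lipschitz v w (lexx `|omega|) (lexx `|omega|)) _.
by rewrite (subrr omega) normr0 mulr0 add0r.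
Qed.

Lemma Lvelocity_rhs (omega theta g : Lp) :
  ((g : R -> R) =
    (fun x => omega x + opK Gamma H theta x
              + eps * opP Gamma H theta omega x + eps * opT Gamma H theta x)
    %[ae lambda in I01]) <-> g = Lvelocity omega theta.
Proof.
have mt := Linfty01_measurable theta; have mw := Linfty01_measurable omega.
have E x := velocityE eps kK kP1 kP2 mt mw (Linfty01_bounded omega) x.
have LE := LvelocityE omega theta.
split=> [h|->].
  apply: Linfty01_eq; move: h LE; apply: filterS2 => x h1 h2 xI.
  by rewrite h1// h2// E.
by move: LE; apply: filterS => x h2 xI; rewrite h2// E.
Qed.

(* Otherwise unification compares two values of Lvelocity by unfolding them. *)
Opaque Lvelocity.

(** A curve from Euler's scheme is differentiable in the strong sense, with the
    Lipschitz derivative [Lvelocity omega (theta t)]. *)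
Lemma strong_solution_exists (omega theta0 : Lp) :
  exists theta, global_strong_solution Gamma H eps omega theta0 theta.
Proof.
pose F (_ : R) (v : Lp) := Lvelocity omega v.
pose M := (`|omega| + M0) * B; pose Lw := Lam `|omega|.
have Lw0 : 0 <= Lw by exact: velocity_lip_ge0.
have Fb t v : `|F t v| <= M by exact: Lvelocity_bound.
have Fl' v w : `|Lvelocity omega v - Lvelocity omega w| <= Lw * `|v - w|.
  exact: Lvelocity_lipschitz_theta.
have Fl s t v w : `|F t v - F s w| <= Lw * (`|t - s| + `|v - w|).
  by apply: le_trans (Fl' v w) _; rewrite ler_wpM2l// lerDr.
have [theta [theta_init anti]] : exists theta, theta 0 = theta0 /\ forall tau,
    has_antiderivative tau (Lw * (1 + M)) (fun t => Lvelocity omega (theta t)) theta.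
  exists (solution F theta0); split; first exact: (solution_initial F theta0).
  move=> tau s t s0 st _.
  exact: (solution_antiderivative Fb Fl Lw0 theta0 (@Linfty01_complete R) s0 st).
exists theta => tau tau0; have {}anti := anti tau.
have M_ge0 : 0 <= M by rewrite mulr_ge0// addr_ge0.
have lt := bounded_antiderivative_lipschitz
  (fun t _ _ => Fb 0 (theta t) : `|Lvelocity omega (theta t)| <= M) anti.
have ld := lipschitz_on_comp Lw0 Fl' lt.
split.
- exact: (lipschitz_on_continuous lt).
- exact: theta_init.
exists (fun t => Lvelocity omega (theta t)); split.
  exact: (antiderivative_W1infty (@Linfty01_norming R) (@Linfty01_complete R) tau0 ld anti).
by apply: nearW => t _; apply/Lvelocity_rhs.
Qed.

Lemma Lvelocity_continuous omega : continuous (Lvelocity omega).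
Proof.
apply: (@lipschitz_continuous _ _ _ (Lam `|omega|)); first exact: velocity_lip_ge0.
exact: Lvelocity_lipschitz_theta.
Qed.

Lemma functional_within_continuous (tau : R) (theta : R -> Lp) l : unit_functional l ->
  {within `[0, tau], continuous theta} -> {within `[0, tau], continuous (l \o theta)}.
Proof.
by move=> ul ct; exact: (within_continuous_comp (W := R^o) ct (functional_continuous ul)).
Qed.

Lemma Lvelocity_within_continuous (tau : R) omega (theta : R -> Lp) :
  {within `[0, tau], continuous theta} ->
  {within `[0, tau], continuous (Lvelocity omega \o theta)}.
Proof. by move=> ct; exact: (within_continuous_comp ct (@Lvelocity_continuous omega)). Qed.

(** For an arbitrary strong solution, only [functional_bochner] is available: each
    functional turns the equation into one between continuous real functions that
    holds in the sense of weak derivatives. *)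
Lemma strong_solution_weak (omega theta0 : Lp) (tau : R) (theta : R -> Lp) l phi :
  strong_solution Gamma H eps omega theta0 tau theta -> unit_functional l ->
  test_function tau phi ->
  \int[lambda]_(x in `[0, tau]) (phi^`()%classic x * l (theta x)) =
  - \int[lambda]_(x in `[0, tau]) (phi x * l (Lvelocity omega (theta x))).
Proof.
move=> [ct _ [dtheta [[_ _ weak] eqn]]] ul tphi.
have [v [b1 b2]] := weak phi tphi.
have [d0 d1 _] := test_function_derivable tphi.
have cphi : continuous phi by move=> x; apply/differentiable_continuous/derivable1_diffP.
have cdphi : continuous phi^`()%classic.
  by move=> x; apply/differentiable_continuous/derivable1_diffP.
have i1 : lambda.-integrable `[0, tau] (EFin \o (fun x => phi^`()%classic x * l (theta x))).
  apply: continuous_integrable => x; apply: cvgM; first exact: (continuous_subspaceT cdphi).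
  exact: (functional_within_continuous ul ct).
have i2 : lambda.-integrable `[0, tau] (EFin \o (fun x => phi x * l (Lvelocity omega (theta x)))).
  apply: continuous_integrable => x; apply: cvgM; first exact: (continuous_subspaceT cphi).
  exact: (functional_within_continuous ul (Lvelocity_within_continuous ct)).
have -> := functional_bochner (mu := lambda) ul (measurable_itv _) b1 i1 _.
  have -> := functional_bochner (mu := lambda) ul (measurable_itv _) b2 i2 _.
    by rewrite (functionalN ul) opprK.
  move: eqn; apply: filterS => t et t0; have {}et := et t0.
  by rewrite (functionalZ ul) ((Lvelocity_rhs _ _ _).1 et).
by apply: nearW => t _; rewrite (functionalZ ul).
Qed.

Lemma strong_solution_growth (omega omega' theta0 theta0' : Lp) (tau W : R)
    (theta theta' : R -> Lp) : `|omega| <= W -> `|omega'| <= W ->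
  strong_solution Gamma H eps omega theta0 tau theta ->
  strong_solution Gamma H eps omega' theta0' tau theta' ->
  forall a b M, 0 <= a -> a <= b -> b <= tau ->
    (forall x, a < x < b -> B * `|omega - omega'| + Lam W * `|theta x - theta' x| <= M) ->
    `|(theta b - theta' b) - (theta a - theta' a)| <= M * (b - a).
Proof.
move=> wW wW' st st' a b M a0 ab bt hM; apply: (norming_le (@Linfty01_norming R)) => l ul.
have [ct _ _] := st; have [ct' _ _] := st'.
have cl := functional_within_continuous ul ct.
have cl' := functional_within_continuous ul ct'.
have cf := functional_within_continuous ul (Lvelocity_within_continuous (omega := omega) ct).
have cf' := functional_within_continuous ul (Lvelocity_within_continuous (omega := omega') ct').
rewrite !(functionalB ul).
have -> : l (theta b) - l (theta' b) - (l (theta a) - l (theta' a)) =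
  ((l \o theta) \- (l \o theta')) b - ((l \o theta) \- (l \o theta')) a by [].
apply: (@weak_derivative_le _ tau ((l \o theta) \- (l \o theta'))
  ((l \o (Lvelocity omega \o theta)) \- (l \o (Lvelocity omega' \o theta')))) => //.
- by move=> x; apply: cvgB; [exact: cl|exact: cl'].
- by move=> x; apply: cvgB; [exact: cf|exact: cf'].
- apply: (weak_derivativeB cl cf cl' cf') => phi tphi.
    exact: (strong_solution_weak st ul tphi).
  exact: (strong_solution_weak st' ul tphi).
move=> x axb /=; rewrite -(functionalB ul); apply: le_trans (hM x axb).
apply: le_trans (ler_norm _) _; case: (ul) => _ _ /(_ _)/le_trans; apply.
exact: Lvelocity_lipschitz.
Qed.

Lemma strong_solution_stability (omega omega' theta0 theta0' : Lp) (tau W : R)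
    (theta theta' : R -> Lp) : 0 <= tau -> `|omega| <= W -> `|omega'| <= W ->
  strong_solution Gamma H eps omega theta0 tau theta ->
  strong_solution Gamma H eps omega' theta0' tau theta' ->
  forall t, 0 <= t -> t <= tau ->
  `|theta t - theta' t| <= 2 ^+ (Num.truncn (2 * tau * Lam W)).+1 *
    (`|theta0 - theta0'| + 2 * tau * (B * `|omega - omega'|)).
Proof.
move=> tau0 wW wW' st st'; have growth := strong_solution_growth wW wW' st st'.
have [ct <- _] := st; have [ct' <- _] := st'.
have W0 : 0 <= W := le_trans (normr_ge0 _) wW.
apply: (@discrete_gronwall _ _ tau (Lam W) _ (fun x => theta x - theta' x)) => //.
- exact: velocity_lip_ge0.
- by rewrite mulr_ge0.
- by move=> x; apply: cvgB; [exact: ct|exact: ct'].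
Qed.

End StrongSolutions.

Section Coefficients.
Context (R : realType).

Lemma Cb_R_lipschitz (Gamma : R -> R) : Cb_R 1 Gamma -> exists M L,
  lipschitz_kernel M L (fun p : R * R => Gamma (p.2 - p.1)).
Proof.
move=> [cG [M GM] /(_ 1 (mem_head _ _))[dG [_ [L GL] _]]].
exists M, L; split=> [p|a b a' b'] //=.
have h := derive_bound_lipschitz (fun x => derivableP (dG x)) GL (b - a) (b' - a').
apply: le_trans h _; apply: ler_wpM2l; first exact: le_trans (normr_ge0 _) (GL 0).
have -> : b - a - (b' - a') = (b - b') - (a - a') by ring.
by rewrite [leRHS]addrC; exact: ler_normB.
Qed.

Lemma Linfty01_pair_norm (u v : Linfty01 R) : `|u| <= `|(u, v)| /\ `|v| <= `|(u, v)|.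
Proof. by rewrite prod_normE/= !le_max !lexx orbT. Qed.

End Coefficients.

Theorem theorem3p6 (R : realType) (Gamma : R -> R) (H : R * R -> R)
  (Gamma_C1 : Cb_R 1 Gamma)
  (Gamma_per : periodic Gamma (pi *+ 2))
  (H_C2 : Cb_R2 2 H)
  (H_per1 : forall b, periodic (fun a => H (a, b)) (pi *+ 2))
  (H_per2 : forall a, periodic (fun b => H (a, b)) (pi *+ 2))
  (eps : R) (eps_gt0 : 0 < eps) :
  (forall omega theta0 : Linfty01 R,
     exists theta : R -> Linfty01 R,
       global_strong_solution Gamma H eps omega theta0 theta /\
       forall theta' : R -> Linfty01 R,
         global_strong_solution Gamma H eps omega theta0 theta' ->
         forall t, 0 <= t -> theta' t = theta t) /\
  (forall tau r : R, 0 < tau -> 0 < r ->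
     exists L : R, forall omega1 theta01 omega2 theta02 : Linfty01 R,
       `|(theta01, omega1)| <= r -> `|(theta02, omega2)| <= r ->
       forall theta1 theta2 : R -> Linfty01 R,
         global_strong_solution Gamma H eps omega1 theta01 theta1 ->
         global_strong_solution Gamma H eps omega2 theta02 theta2 ->
         forall t, t \in `[0, tau] ->
           `|theta1 t - theta2 t| <=
           L * `|(theta01, omega1) - (theta02, omega2)|).
Proof.
have [MG [LG kG]] := Cb_R_lipschitz Gamma_C1.
have [MH [LH kH]] := Cb_kernel (Cb_le (k := 1) H_C2).
have [_ _ dH] := H_C2.
have e2 : (0, 1) \in [:: ((1, 0) : R * R); (0, 1)] by rewrite !inE eqxx orbT.
have [M1 [L1 k1]] := Cb_kernel (dH _ (mem_head _ _)).2.
have [M2 [L2 k2]] := Cb_kernel (dH _ e2).2.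
have kK := lipschitz_kernelM kH kG.
have kP1 := lipschitz_kernelM kG k1.
have kP2 := lipschitz_kernelM kG k2.
have stab := strong_solution_stability kK kP1 kP2 (ltW eps_gt0).
split=> [omega theta0|tau r tau0 r0].
  have [theta sol] := strong_solution_exists kK kP1 kP2 (ltW eps_gt0) omega theta0.
  exists theta; split => // theta' sol' t t0.
  have t1 : 0 < t + 1 by rewrite ltr_wpDl.
  apply/eqP; rewrite -subr_eq0 -normr_le0.
  have tt1 : t <= t + 1 by rewrite lerDl.
  have := stab _ _ _ _ _ _ _ _ (ltW t1) (lexx _) (lexx _) (sol' _ t1) (sol _ t1) t t0 tt1.
  by rewrite (subrr theta0) (subrr omega) normr0 !mulr0 addr0 mulr0.
have [M1_ge0 _] := lipschitz_kernel_ge0 kP1; have [M2_ge0 _] := lipschitz_kernel_ge0 kP2.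
set B := 1 + eps * (MG * M1 + MG * M2).
have B0 : 0 <= B by rewrite addr_ge0// mulr_ge0 ?(ltW eps_gt0)// addr_ge0.
set N := (Num.truncn (2 * tau * velocity_lip eps (MH * MG) (LH * MG + MH * LG)
  (MG * M1) (LG * M1 + MG * L1) (MG * M2) (LG * M2 + MG * L2) r)).+1.
exists (2 ^+ N * (1 + 2 * tau * B)) => omega1 theta01 omega2 theta02 b1 b2 theta1 theta2 s1 s2 t.
rewrite in_itv/= => /andP[t0 tt].
have w1 := le_trans (Linfty01_pair_norm theta01 omega1).2 b1.
have w2 := le_trans (Linfty01_pair_norm theta02 omega2).2 b2.
apply: le_trans (stab _ _ _ _ _ _ _ _ (ltW tau0) w1 w2 (s1 _ tau0) (s2 _ tau0) t t0 tt) _.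
have [d1 d2] := Linfty01_pair_norm (theta01 - theta02) (omega1 - omega2).
rewrite -[leRHS]mulrA; apply: ler_wpM2l; first exact: exprn_ge0.
rewrite [leRHS]mulrDl mul1r; apply: lerD => //.
rewrite -[leRHS]mulrA; apply: ler_wpM2l; last exact: ler_wpM2l.
by rewrite mulr_ge0// ltW.
Qed.
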